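(* Let the delay $r>0$, $\boldsymbol f(\cdot)$ and $M$ be as in the context and let $K\in\mathbb R^{p\times n}$ be the gain of the uncertain closed-loop system (CLS) of the context. The uncertain CLS with supply rate function $\mathsf s$ is robustly dissipative subject to the uncertainty constraints, and the trivial solution $\boldsymbol x(t)\equiv\mathbf 0_n$ of the uncertain CLS with $\boldsymbol w(t)\equiv\mathbf 0_q$ is robustly globally asymptotically stable subject to the uncertainty constraints, if there exist $P\in\mathbb S^n$, $Q\in\mathbb R^{n\times dn}$, $R\in\mathbb S^{dn}$, $S,U\in\mathbb S^n$ and $\varkappa_1,\varkappa_2>0$ such that $$\begin{bmatrix}P&Q\\ *&R+\mathsf F\otimes S\end{bmatrix}\succ0,\quad S\succ0,\quad U\succ0,\qquad\begin{bmatrix}I&-I-\varkappa_1\mathbf F_\Delta^\top\mathbf J_2&\varkappa_1\mathbf F_\Delta^\top\\ *&I-\varkappa_1\mathbf J_3&\mathsf O\\ *&*&\varkappa_1\mathbf J_1\end{bmatrix}\succ0,$$ $$\begin{bmatrix}\mathsf{Sy}(\mathbf P^\top\boldsymbol\Pi)+\boldsymbol\Phi&\mathbf G+\varkappa_2\mathbf H^\top\mathbf J_2&\varkappa_2\mathbf H^\top\\ *&\varkappa_2\mathbf F_\Delta^\top\mathbf J_2+\varkappa_2\mathbf J_2^\top\mathbf F_\Delta+\varkappa_2\mathbf J_3&\varkappa_2\mathbf F_\Delta^\top\\ *&*&-\varkappa_2\mathbf J_1\end{bmatrix}\prec0,$$ where $\mathsf F^{-1}=\int_{-r}^0\boldsymbol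 f\boldsymbol f^\top d\tau$; $\mathbf P=[P\ \ \mathsf O_n\ \ Q\ \ \mathsf O_{n,q}\ \ \mathsf O_{n,m}]$; $\boldsymbol\Pi=[\mathbf A+\mathbf B_1[(I_{2+d}\otimes K)\oplus\mathsf O_q]\ \ \mathsf O_{n,m}]$; $$\boldsymbol\Phi=\mathsf{Sy}\left(\begin{bmatrix}Q\\ \mathsf O_{n,dn}\\ R\\ \mathsf O_{(q+m),dn}\end{bmatrix}\begin{bmatrix}\mathbf F&\mathsf O_{dn,m}\end{bmatrix}\right)+\mathsf{Sy}\left(\begin{bmatrix}\mathsf O_{(2n+dn),m}\\ -J_2^\top\\ \widetilde J\end{bmatrix}\begin{bmatrix}\boldsymbol\Sigma&\mathsf O_m\end{bmatrix}\right)+(S+rU)\oplus(-S)\oplus(-\mathsf F\otimes U)\oplus(-J_3)\oplus J_1,$$ $\mathbf F=[F(0)\ \ -F(-r)\ \ -M\otimes I_n\ \ \mathsf O_{dn,q}]$, $\boldsymbol\Sigma=\mathbf C+\mathbf B_2[(I_{2+d}\otimes K)\oplus\mathsf O_q]$; and $$\mathbf G=\begin{bmatrix}P&\mathsf O_{n,m}\\ \mathsf O_n&\mathsf O_{n,m}\\ Q^\top&\mathsf O_{dn,m}\\ \mathsf O_{q,n}&-J_2^\top\\ \mathsf O_{m,n}&\widetilde J\end{bmatrix}\begin{bmatrix}\mathsf{Row}_{i=1}^7G_i&\mathsf O\\ \mathsf O&\mathsf{Row}_{i=8}^{14}G_i\end{bmatrix},\qquad\mathbf H=\begin{bmatrix}\mathbf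 H_1\\ \mathbf H_2\end{bmatrix}\begin{bmatrix}I_{2n+dn+q}&\mathsf O_{(2n+dn+q),m}\end{bmatrix},$$ $\mathbf F_\Delta=\bigoplus_{i=1}^{14}F_i$, $\mathbf J_1=\bigoplus_{i=1}^{14}\Xi_i$, $\mathbf J_2=\bigoplus_{i=1}^{14}\Lambda_i$, $\mathbf J_3=\bigoplus_{i=1}^{14}\Gamma_i$.
   Context: Notation: $\mathsf{Sy}(X)=X+X^\top$; $\mathsf{Row}_iX_i$ concatenates horizontally; $\oplus$ is block-diagonal sum; $\otimes$ Kronecker product; $\mathbb S^n$ = real symmetric $n\times n$ matrices; $\mathsf O_{n,m}$ zero matrix, $\mathsf O_n=\mathsf O_{n,n}$; unlabelled $I,\mathsf O$ have compatible sizes; $*$ denotes blocks determined by symmetry. Functions: $\boldsymbol f\in C^1([-r,0];\mathbb R^d)$ satisfies $\boldsymbol f'(\tau)=M\boldsymbol f(\tau)$, $M\in\mathbb R^{d\times d}$, and $\int_{-r}^0\boldsymbol f\boldsymbol f^\top d\tau\succ0$; $F(\tau)=\boldsymbol f(\tau)\otimes I_n$. Uncertain open-loop system, $t\ge t_0$: $\dot{\boldsymbol x}(t)=\grave A_1\boldsymbol x(t)+\grave A_2\boldsymbol x(t-r)+\int_{-r}^0\grave A_3F(\tau)\boldsymbol x(t+\tau)d\tau+\grave B_1\boldsymbol u(t)+\grave B_2\boldsymbol u(t-r)+\int_{-r}^0\grave B_3(\boldsymbol f(\tau)\otimes I_p)\boldsymbol u(t+\tau)d\tau+\grave D_1\boldsymbol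 w(t)$, $\boldsymbol z(t)=\grave C_1\boldsymbol x(t)+\grave C_2\boldsymbol x(t-r)+\int_{-r}^0\grave C_3F(\tau)\boldsymbol x(t+\tau)d\tau+\grave B_4\boldsymbol u(t)+\grave B_5\boldsymbol u(t-r)+\int_{-r}^0\grave B_6(\boldsymbol f(\tau)\otimes I_p)\boldsymbol u(t+\tau)d\tau+\grave D_2\boldsymbol w(t)$, $\boldsymbol x\in\mathbb R^n,\boldsymbol u\in\mathbb R^p,\boldsymbol z\in\mathbb R^m$, $\boldsymbol w\in\mathcal L^2([t_0,\infty);\mathbb R^q)$, $\boldsymbol x(t_0+\theta)=\boldsymbol\phi(\theta)$ on $[-r,0]$ with $\boldsymbol\phi$ continuous, where $[\grave A_1\ \grave B_1\ \grave A_2\ \grave B_2\ \grave A_3\ \grave B_3\ \grave D_1]=[A_1\ B_1\ A_2\ B_2\ A_3\ B_3\ D_1]+\mathsf{Row}_{i=1}^7G_i(I-\Delta_iF_i)^{-1}\Delta_iH_i$, $[\grave C_1\ \grave B_4\ \grave C_2\ \grave B_5\ \grave C_3\ \grave B_6\ \grave D_2]=[C_1\ B_4\ C_2\ B_5\ C_3\ B_6\ D_2]+\mathsf{Row}_{i=8}^{14}G_i(I-\Delta_iF_i)^{-1}\Delta_iH_i$, with given $G_i,F_i,H_i$ and uncertainties constrained, for $i=1,\dots,14$, by $\begin{bmatrix}I\\ \Delta_i\end{bmatrix}^\top\begin{bmatrix}\Xi_i^{-1}&\Lambda_i\\ *&\Gamma_i\end{bmatrix}\begin{bmatrix}I\\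 \Delta_i\end{bmatrix}\succeq0$, with given $\Xi_i\succ0$, $\Gamma_i\preceq0$, $\Lambda_i$. Uncertain CLS ($\boldsymbol u=K\boldsymbol x$): with $\boldsymbol\chi(t)$ stacking $\boldsymbol x(t)$, $\boldsymbol x(t-r)$, $\int_{-r}^0F(\tau)\boldsymbol x(t+\tau)d\tau$, $\boldsymbol w(t)$, $\dot{\boldsymbol x}=\big(\mathbf A+\mathbf B_1[(I_{2+d}\otimes K)\oplus\mathsf O_q]+\mathsf{Row}_{i=1}^7G_i\,(I-\bigoplus_{i=1}^7\Delta_iF_i)^{-1}(\bigoplus_{i=1}^7\Delta_i)\mathbf H_1\big)\boldsymbol\chi$, $\boldsymbol z=\big(\mathbf C+\mathbf B_2[(I_{2+d}\otimes K)\oplus\mathsf O_q]+\mathsf{Row}_{i=8}^{14}G_i\,(I-\bigoplus_{i=8}^{14}\Delta_iF_i)^{-1}(\bigoplus_{i=8}^{14}\Delta_i)\mathbf H_2\big)\boldsymbol\chi$, where $\mathbf A=[A_1\ A_2\ A_3\ D_1]$, $\mathbf B_1=[B_1\ B_2\ B_3\ \mathsf O_{n,q}]$, $\mathbf C=[C_1\ C_2\ C_3\ D_2]$, $\mathbf B_2=[B_4\ B_5\ B_6\ \mathsf O_{m,q}]$ and $\mathbf H_1=\begin{bmatrix}H_1\\ H_2K\end{bmatrix}\oplus\begin{bmatrix}H_3\\ H_4K\end{bmatrix}\oplus\begin{bmatrix}H_5\\ H_6(I_d\otimes K)\end{bmatrix}\oplus H_7$, $\mathbf H_2=\begin{bmatrix}H_8\\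 H_9K\end{bmatrix}\oplus\begin{bmatrix}H_{10}\\ H_{11}K\end{bmatrix}\oplus\begin{bmatrix}H_{12}\\ H_{13}(I_d\otimes K)\end{bmatrix}\oplus H_{14}$. Supply rate: $\mathsf s(\boldsymbol z,\boldsymbol w)=\begin{bmatrix}\boldsymbol z\\ \boldsymbol w\end{bmatrix}^\top\begin{bmatrix}\widetilde J^\top J_1^{-1}\widetilde J&J_2\\ *&J_3\end{bmatrix}\begin{bmatrix}\boldsymbol z\\ \boldsymbol w\end{bmatrix}$, $J_1\in\mathbb S^m$, $J_1^{-1}\prec0$, $\widetilde J\in\mathbb R^{m\times m}$, $J_2\in\mathbb R^{m\times q}$, $J_3\in\mathbb S^q$. Dissipative: there is a differentiable $\mathsf v:C([-r,0];\mathbb R^n)\to\mathbb R_{\ge0}$ with $\frac d{dt}\mathsf v(\mathbf x_t(\cdot))-\mathsf s(\boldsymbol z(t),\boldsymbol w(t))\le0$ for all $t\ge t_0$, $\mathbf x_t(\theta)=\boldsymbol x(t+\theta)$. ''Robustly ... subject to the uncertainty constraints'' means for all $\Delta_i$, $i=1,\dots,14$, satisfying $\begin{bmatrix}I\\ \Delta_i\end{bmatrix}^\top\begin{bmatrix}\Xi_i^{-1}&\Lambda_i\\ *&\Gamma_i\end{bmatrix}\begin{bmatrix}I\\ \Delta_i\end{bmatrix}\succeq0$ (the inverses $(I-\Delta_iF_i)^{-1}$ being well defined). *)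

(* Defs.v *)
From HB Require Import structures.
From mathcomp Require Import all_boot all_order all_algebra.
From mathcomp Require Import all_classical all_reals all_analysis.
From mathcomp Require Import mxtens.

Set Implicit Arguments.
Unset Strict Implicit.
Unset Printing Implicit Defensive.

Import Order.TTheory GRing.Theory Num.Theory.
Import numFieldNormedType.Exports.

Local Open Scope classical_set_scope.
Local Open Scope ring_scope.

Definition Sy (R : realType) (k : nat) (X : 'M[R]_k) : 'M[R]_k := X + X^T.

Definition qform (R : realType) (k : nat) (A : 'M[R]_k) (x : 'cV[R]_k) : R :=
  (x^T *m A *m x) 0 0.

Definition posdef (R : realType) (k : nat) (A : 'M[R]_k) : Prop :=
  A^T = A /\ forall x : 'cV[R]_k, x != 0 -> 0 < qform A x.

Definition possemidef (R : realType) (k : nat) (A : 'M[R]_k) : Prop :=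
  A^T = A /\ forall x : 'cV[R]_k, 0 <= qform A x.

Definition negdef (R : realType) (k : nat) (A : 'M[R]_k) : Prop :=
  posdef (- A).

Definition negsemidef (R : realType) (k : nat) (A : 'M[R]_k) : Prop :=
  possemidef (- A).

Definition dsum (R : realType) (k1 l1 k2 l2 : nat)
    (A : 'M[R]_(k1, l1)) (B : 'M[R]_(k2, l2)) : 'M[R]_(k1 + k2, l1 + l2) :=
  block_mx A 0 0 B.

(** The association ((1 (+) 2) (+) ((3 (+) 4) (+) (5 (+) 6))) (+) 7 is the one
    for which the block dimensions agree definitionally with those of
    [rowG], [bigH] and [chi] below. *)
Definition dsum7 (R : realType) (k1 l1 k2 l2 k3 l3 k4 l4 k5 l5 k6 l6 k7 l7 : nat)
    (X1 : 'M[R]_(k1, l1)) (X2 : 'M[R]_(k2, l2)) (X3 : 'M[R]_(k3, l3))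
    (X4 : 'M[R]_(k4, l4)) (X5 : 'M[R]_(k5, l5)) (X6 : 'M[R]_(k6, l6))
    (X7 : 'M[R]_(k7, l7)) :=
  dsum (dsum (dsum X1 X2) (dsum (dsum X3 X4) (dsum X5 X6))) X7.

(** Symmetric 3 x 3 block matrix given by its upper triangle. *)
Definition symblock3 (R : realType) (k1 k2 k3 : nat)
    (X11 : 'M[R]_k1) (X12 : 'M[R]_(k1, k2)) (X13 : 'M[R]_(k1, k3))
    (X22 : 'M[R]_k2) (X23 : 'M[R]_(k2, k3)) (X33 : 'M[R]_k3)
    : 'M[R]_(k1 + (k2 + k3)) :=
  block_mx X11 (row_mx X12 X13)
           (row_mx X12 X13)^T (block_mx X22 X23 X23^T X33).

Definition mxint (R : realType) (k l : nat) (a b : R) (A : R -> 'M[R]_(k, l))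
    : 'M[R]_(k, l) :=
  \matrix_(i, j) \int[@lebesgue_measure R]_(tau in `[a, b]) (A tau i j).

(** [l] is the derivative at [t] of [g] regarded as a function on [D]; it is
    one-sided when [t] is an end point of the interval [D]. *)
Definition deriv_on (R : realType) (V : normedModType R) (D : set R)
    (g : R -> V) (t : R) (l : V) : Prop :=
  h^-1 *: (g (t + h) - g t) @[h --> within [set h | D (t + h)] 0^'] --> l.

Definition C1_on (R : realType) (V : normedModType R) (D : set R)
    (g : R -> V) : Prop :=
  exists dg : R -> V,
    (forall t, D t -> deriv_on D g t (dg t)) /\ {within D, continuous dg}.

Definition L2_from (R : realType) (k : nat) (t0 : R) (w : R -> 'cV[R]_k) : Prop :=
  forall i, measurable_fun `[t0, +oo[ (fun t => w t i 0) /\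
    (@lebesgue_measure R).-integrable `[t0, +oo[
      (fun t => ((w t i 0) ^+ 2)%:E).

(** Elements of C([-r, 0]; R^n) are represented by functions on the whole line, of which only
    the values on [-r, 0] matter. *)

Definition hist_cont (R : realType) (n : nat) (r : R) (phi : R -> 'cV[R]_n) : Prop :=
  {within `[- r, 0], continuous phi}.

Definition sup_norm (R : realType) (n : nat) (r : R) (phi : R -> 'cV[R]_n) : R :=
  sup [set `|phi theta| | theta in `[- r, 0]].

(** [v] is a function C([-r, 0]; R^n) -> [0, +oo[. *)
Definition hist_functional (R : realType) (n : nat) (r : R)
    (v : (R -> 'cV[R]_n) -> R) : Prop :=
  (forall phi psi, hist_cont r phi -> hist_cont r psi ->
     (forall theta, theta \in `[- r, 0] -> phi theta = psi theta) ->
     v phi = v psi) /\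
  (forall phi, hist_cont r phi -> 0 <= v phi).

(** Frechet differentiability on C([-r, 0]; R^n) with the sup norm. *)
Definition hist_differentiable (R : realType) (n : nat) (r : R)
    (v : (R -> 'cV[R]_n) -> R) : Prop :=
  forall phi, hist_cont r phi ->
  exists L : (R -> 'cV[R]_n) -> R,
  [/\ (forall (a : R) h1 h2, hist_cont r h1 -> hist_cont r h2 ->
         L (fun theta => a *: h1 theta + h2 theta) = a * L h1 + L h2),
      (exists c : R, forall h, hist_cont r h -> `|L h| <= c * sup_norm r h) &
      (forall e : R, 0 < e -> exists2 delta : R, 0 < delta &
         forall h, hist_cont r h -> sup_norm r h < delta ->
         `|v (fun theta => phi theta + h theta) - v phi - L h|
           <= e * sup_norm r h)].

Definition segment (R : realType) (n : nat) (x : R -> 'cV[R]_n) (t : R)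
    : R -> 'cV[R]_n :=
  fun theta => x (t + theta).

Record plant (R : realType) (d n p m q : nat) := Plant {
  A1 : 'M[R]_n;        A2 : 'M[R]_n;        A3 : 'M[R]_(n, d * n);
  B1 : 'M[R]_(n, p);   B2 : 'M[R]_(n, p);   B3 : 'M[R]_(n, d * p);
  D1 : 'M[R]_(n, q);
  C1 : 'M[R]_(m, n);   C2 : 'M[R]_(m, n);   C3 : 'M[R]_(m, d * n);
  B4 : 'M[R]_(m, p);   B5 : 'M[R]_(m, p);   B6 : 'M[R]_(m, d * p);
  D2 : 'M[R]_(m, q) }.

(** One uncertainty channel: the perturbation
    G (I - Delta F)^-1 Delta H of a g x h coefficient, with Delta of size
    [dr] x [dc], and the multiplier (Xi, Lambda, Gamma) constraining Delta. *)
Record channel (R : realType) (g h : nat) := Channel {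
  dr : nat;
  dc : nat;
  chG : 'M[R]_(g, dr);
  chF : 'M[R]_(dc, dr);
  chH : 'M[R]_(dc, h);
  chXi : 'M[R]_dc;
  chLambda : 'M[R]_(dc, dr);
  chGamma : 'M[R]_dr }.

(** The seven channels of an equation with [g] rows: with [g = n] they perturb
    A1, B1, A2, B2, A3, B3, D1 (indices 1 to 7), and with [g = m] they perturb
    C1, B4, C2, B5, C3, B6, D2 (indices 8 to 14). *)
Record channels (R : realType) (d n p q g : nat) := Channels {
  ch1 : channel R g n;        ch2 : channel R g p;
  ch3 : channel R g n;        ch4 : channel R g p;
  ch5 : channel R g (d * n);  ch6 : channel R g (d * p);
  ch7 : channel R g q }.

Record deltas (R : realType) (d n p q g : nat) (c : channels R d n p q g) := Deltas {
  delta1 : 'M[R]_(dr (ch1 c), dc (ch1 c));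
  delta2 : 'M[R]_(dr (ch2 c), dc (ch2 c));
  delta3 : 'M[R]_(dr (ch3 c), dc (ch3 c));
  delta4 : 'M[R]_(dr (ch4 c), dc (ch4 c));
  delta5 : 'M[R]_(dr (ch5 c), dc (ch5 c));
  delta6 : 'M[R]_(dr (ch6 c), dc (ch6 c));
  delta7 : 'M[R]_(dr (ch7 c), dc (ch7 c)) }.

Definition multiplier_ok (R : realType) (g h : nat) (c : channel R g h) : Prop :=
  posdef (chXi c) /\ negsemidef (chGamma c).

Definition multipliers_ok (R : realType) (d n p q g : nat)
    (c : channels R d n p q g) : Prop :=
  [/\ multiplier_ok (ch1 c), multiplier_ok (ch2 c), multiplier_ok (ch3 c) &
      multiplier_ok (ch4 c)] /\
  [/\ multiplier_ok (ch5 c), multiplier_ok (ch6 c) & multiplier_ok (ch7 c)].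

Definition admissible1 (R : realType) (g h : nat) (c : channel R g h)
    (D : 'M[R]_(dr c, dc c)) : Prop :=
  possemidef ((col_mx 1%:M D)^T
    *m block_mx (invmx (chXi c)) (chLambda c) (chLambda c)^T (chGamma c)
    *m col_mx 1%:M D).

Definition admissible (R : realType) (d n p q g : nat)
    (c : channels R d n p q g) (D : deltas c) : Prop :=
  [/\ admissible1 (delta1 D), admissible1 (delta2 D), admissible1 (delta3 D) &
      admissible1 (delta4 D)] /\
  [/\ admissible1 (delta5 D), admissible1 (delta6 D) & admissible1 (delta7 D)].

Definition well_posed1 (R : realType) (g h : nat) (c : channel R g h)
    (D : 'M[R]_(dr c, dc c)) : Prop :=
  1%:M - D *m chF c \in unitmx.

Definition well_posed (R : realType) (d n p q g : nat)
    (c : channels R d n p q g) (D : deltas c) : Prop :=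
  [/\ well_posed1 (delta1 D), well_posed1 (delta2 D), well_posed1 (delta3 D) &
      well_posed1 (delta4 D)] /\
  [/\ well_posed1 (delta5 D), well_posed1 (delta6 D) & well_posed1 (delta7 D)].

(** A property of the uncertain system holds robustly if, for all admissible
    uncertainties, the inverses in the system exist and the property holds. *)
Definition robustly (R : realType) (d n p q g g' : nat)
    (cx : channels R d n p q g) (cz : channels R d n p q g')
    (prop : deltas cx -> deltas cz -> Prop) : Prop :=
  forall (Dx : deltas cx) (Dz : deltas cz),
    admissible Dx -> admissible Dz ->
    [/\ well_posed Dx, well_posed Dz & prop Dx Dz].

Section Aggregates.
Context (R : realType) (d n p q g : nat) (c : channels R d n p q g).

Definition rowG :=
  row_mx (row_mx (row_mx (chG (ch1 c)) (chG (ch2 c)))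
                 (row_mx (row_mx (chG (ch3 c)) (chG (ch4 c)))
                         (row_mx (chG (ch5 c)) (chG (ch6 c)))))
         (chG (ch7 c)).

Definition sumF := dsum7 (chF (ch1 c)) (chF (ch2 c)) (chF (ch3 c))
  (chF (ch4 c)) (chF (ch5 c)) (chF (ch6 c)) (chF (ch7 c)).

Definition sumXi := dsum7 (chXi (ch1 c)) (chXi (ch2 c)) (chXi (ch3 c))
  (chXi (ch4 c)) (chXi (ch5 c)) (chXi (ch6 c)) (chXi (ch7 c)).

Definition sumLambda := dsum7 (chLambda (ch1 c)) (chLambda (ch2 c))
  (chLambda (ch3 c)) (chLambda (ch4 c)) (chLambda (ch5 c)) (chLambda (ch6 c))
  (chLambda (ch7 c)).

Definition sumGamma := dsum7 (chGamma (ch1 c)) (chGamma (ch2 c))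
  (chGamma (ch3 c)) (chGamma (ch4 c)) (chGamma (ch5 c)) (chGamma (ch6 c))
  (chGamma (ch7 c)).

Definition bigH (K : 'M[R]_(p, n)) :=
  dsum
    (dsum (col_mx (chH (ch1 c)) (chH (ch2 c) *m K))
       (dsum (col_mx (chH (ch3 c)) (chH (ch4 c) *m K))
             (col_mx (chH (ch5 c)) (chH (ch6 c) *m ((1%:M : 'M[R]_d) *t K)))))
    (chH (ch7 c)).

Definition sumDelta (D : deltas c) := dsum7 (delta1 D) (delta2 D) (delta3 D)
  (delta4 D) (delta5 D) (delta6 D) (delta7 D).

Definition sumDeltaF (D : deltas c) := dsum7
  (delta1 D *m chF (ch1 c)) (delta2 D *m chF (ch2 c)) (delta3 D *m chF (ch3 c))
  (delta4 D *m chF (ch4 c)) (delta5 D *m chF (ch5 c)) (delta6 D *m chF (ch6 c))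
  (delta7 D *m chF (ch7 c)).

End Aggregates.

(** Dimension of chi(t), with blocks x(t), x(t - r), the integral, w(t). *)
Notation chidim d n q := ((n + (n + d * n)) + q)%N.

(** F(tau) = f(tau) (x) I_n. *)
Definition Fkron (R : realType) (d : nat) (n : nat) (f : R -> 'cV[R]_d) (tau : R)
    : 'M[R]_(d * n, n) :=
  castmx (erefl, mul1n n) (f tau *t (1%:M : 'M[R]_n)).

Definition chi (R : realType) (d n q : nat) (r : R) (f : R -> 'cV[R]_d)
    (x : R -> 'cV[R]_n) (w : R -> 'cV[R]_q) (t : R) : 'cV[R]_(chidim d n q) :=
  col_mx
    (col_mx (x t)
       (col_mx (x (t - r))
               (mxint (- r) 0 (fun tau => Fkron n f tau *m x (t + tau)))))
    (w t).

(** (I_(2+d) (x) K) (+) O_q; [(2 + d) * n] is convertible to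
    [n + (n + d * n)]. *)
Definition gainmx (R : realType) (d n p q : nat) (K : 'M[R]_(p, n))
    : 'M[R]_(chidim d p q, chidim d n q) :=
  dsum ((1%:M : 'M[R]_(2 + d)) *t K
          : 'M[R]_(p + (p + d * p), n + (n + d * n)))
       (0 : 'M[R]_q).

(** The nominal closed-loop matrices A + B1 [..] and Sigma = C + B2 [..]. *)
Definition state_nom (R : realType) (d n p m q : nat) (pl : plant R d n p m q)
    (K : 'M[R]_(p, n)) : 'M[R]_(n, chidim d n q) :=
  row_mx (row_mx (A1 pl) (row_mx (A2 pl) (A3 pl))) (D1 pl) +
  row_mx (row_mx (B1 pl) (row_mx (B2 pl) (B3 pl))) (0 : 'M[R]_(n, q))
    *m gainmx d q K.

Definition output_nom (R : realType) (d n p m q : nat) (pl : plant R d n p m q)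
    (K : 'M[R]_(p, n)) : 'M[R]_(m, chidim d n q) :=
  row_mx (row_mx (C1 pl) (row_mx (C2 pl) (C3 pl))) (D2 pl) +
  row_mx (row_mx (B4 pl) (row_mx (B5 pl) (B6 pl))) (0 : 'M[R]_(m, q))
    *m gainmx d q K.

Definition perturbation (R : realType) (d n p q g : nat)
    (c : channels R d n p q g) (D : deltas c) (K : 'M[R]_(p, n))
    : 'M[R]_(g, chidim d n q) :=
  rowG c *m invmx (1%:M - sumDeltaF D) *m sumDelta D *m bigH c K.

Definition state_mx (R : realType) (d n p m q : nat) (pl : plant R d n p m q)
    (cx : channels R d n p q n) (Dx : deltas cx) (K : 'M[R]_(p, n)) :=
  state_nom pl K + perturbation Dx K.

Definition output_mx (R : realType) (d n p m q : nat) (pl : plant R d n p m q)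
    (cz : channels R d n p q m) (Dz : deltas cz) (K : 'M[R]_(p, n)) :=
  output_nom pl K + perturbation Dz K.

(** [x] solves x' = Omega chi for t >= t0 with x(t0 + .) = phi on [-r, 0].
    As [w] is only square integrable, this is meant in the sense of
    Caratheodory: the equation is integrated. It includes every continuous
    [x] satisfying the differential equation at all t >= t0. *)
Definition is_solution (R : realType) (d n q : nat) (r t0 : R)
    (f : R -> 'cV[R]_d) (Omega : 'M[R]_(n, chidim d n q))
    (phi : R -> 'cV[R]_n) (w : R -> 'cV[R]_q) (x : R -> 'cV[R]_n) : Prop :=
  [/\ {within `[t0 - r, +oo[, continuous x},
      (forall theta, theta \in `[- r, 0] -> x (t0 + theta) = phi theta) &
      (forall t, t0 <= t ->
         x t = phi 0 + mxint t0 t (fun s => Omega *m chi r f x w s))].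

Definition supply (R : realType) (m q : nat) (Jt J1 : 'M[R]_m)
    (J2 : 'M[R]_(m, q)) (J3 : 'M[R]_q) (z : 'cV[R]_m) (w : 'cV[R]_q) : R :=
  qform (block_mx (Jt^T *m invmx J1 *m Jt) J2 J2^T J3) (col_mx z w).

(** The dissipation inequality is required at every t >= t0 at which
    x'(t) exists and satisfies the state equation: that is at all t >= t0 for
    classical solutions and at almost all t >= t0 in general. *)
Definition dissipative (R : realType) (d n m q : nat) (r t0 : R)
    (f : R -> 'cV[R]_d) (Omega : 'M[R]_(n, chidim d n q))
    (Psi : 'M[R]_(m, chidim d n q))
    (s : 'cV[R]_m -> 'cV[R]_q -> R) : Prop :=
  exists v : (R -> 'cV[R]_n) -> R,
  [/\ hist_functional r v, hist_differentiable r v &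
      forall phi w x, hist_cont r phi -> L2_from t0 w ->
        is_solution r t0 f Omega phi w x ->
      forall t, t0 <= t ->
        deriv_on `[t0, +oo[ x t (Omega *m chi r f x w t) ->
      exists2 dv : R, deriv_on `[t0, +oo[ (fun s => v (segment x s) : R^o) t dv &
        dv - s (Psi *m chi r f x w t) (w t) <= 0].

(** Global asymptotic stability of x = 0 for the system with w = 0: Lyapunov
    stability and global attractivity. *)
Definition globally_asymptotically_stable (R : realType) (d n q : nat)
    (r t0 : R) (f : R -> 'cV[R]_d) (Omega : 'M[R]_(n, chidim d n q)) : Prop :=
  (forall e : R, 0 < e -> exists2 delta : R, 0 < delta &
     forall phi x, hist_cont r phi -> sup_norm r phi < delta ->
       is_solution r t0 f Omega phi (fun=> 0) x ->
     forall t, t0 <= t -> `|x t| < e) /\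
  (forall phi x, hist_cont r phi ->
     is_solution r t0 f Omega phi (fun=> 0) x ->
   x t @[t --> +oo] --> (0 : 'cV[R]_n)).

Definition gram (R : realType) (d : nat) (r : R) (f : R -> 'cV[R]_d) : 'M[R]_d :=
  mxint (- r) 0 (fun tau => f tau *m (f tau)^T).

Definition Fgram (R : realType) (d : nat) (r : R) (f : R -> 'cV[R]_d) : 'M[R]_d :=
  invmx (gram r f).

Definition lyap_lmi (R : realType) (d n : nat) (r : R) (f : R -> 'cV[R]_d)
    (P : 'M[R]_n) (Q : 'M[R]_(n, d * n)) (R0 : 'M[R]_(d * n)) (S : 'M[R]_n)
    : 'M[R]_(n + d * n) :=
  block_mx P Q Q^T (R0 + Fgram r f *t S).

Section Lmi.
Context (R : realType) (d n p m q : nat).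
Context (cx : channels R d n p q n) (cz : channels R d n p q m).

Definition FDelta := dsum (sumF cx) (sumF cz).
Definition bigJ1 := dsum (sumXi cx) (sumXi cz).
Definition bigJ2 := dsum (sumLambda cx) (sumLambda cz).
Definition bigJ3 := dsum (sumGamma cx) (sumGamma cz).

Definition well_posed_lmi (k1 : R) :=
  symblock3
    1%:M (- 1%:M - k1 *: (FDelta^T *m bigJ2)) (k1 *: FDelta^T)
    (1%:M - k1 *: bigJ3) 0
    (k1 *: bigJ1).

Definition bfP (P : 'M[R]_n) (Q : 'M[R]_(n, d * n))
    : 'M[R]_(n, chidim d n q + m) :=
  row_mx (row_mx (row_mx P (row_mx (0 : 'M[R]_n) Q)) (0 : 'M[R]_(n, q)))
         (0 : 'M[R]_(n, m)).

Definition bfPi (pl : plant R d n p m q) (K : 'M[R]_(p, n))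
    : 'M[R]_(n, chidim d n q + m) :=
  row_mx (state_nom pl K) (0 : 'M[R]_(n, m)).

Definition bfF (r : R) (f : R -> 'cV[R]_d) (M : 'M[R]_d)
    : 'M[R]_(d * n, chidim d n q) :=
  row_mx (row_mx (Fkron n f 0)
                 (row_mx (- Fkron n f (- r)) (- (M *t (1%:M : 'M[R]_n)))))
         (0 : 'M[R]_(d * n, q)).

Definition bfPhi (r : R) (f : R -> 'cV[R]_d) (M : 'M[R]_d)
    (pl : plant R d n p m q) (K : 'M[R]_(p, n))
    (Jt J1 : 'M[R]_m) (J2 : 'M[R]_(m, q)) (J3 : 'M[R]_q)
    (Q : 'M[R]_(n, d * n)) (R0 : 'M[R]_(d * n)) (S U : 'M[R]_n)
    : 'M[R]_(chidim d n q + m) :=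
  Sy (col_mx (col_mx (col_mx Q (col_mx (0 : 'M[R]_(n, d * n)) R0))
                     (0 : 'M[R]_(q, d * n)))
             (0 : 'M[R]_(m, d * n))
        *m row_mx (bfF r f M) (0 : 'M[R]_(d * n, m)))
  + Sy (col_mx (col_mx (0 : 'M[R]_(n + (n + d * n), m)) (- J2^T)) Jt
        *m row_mx (output_nom pl K) (0 : 'M[R]_m))
  + dsum (dsum (dsum (S + r *: U) (dsum (- S) (- (Fgram r f *t U)))) (- J3)) J1.

Definition bfG (Jt : 'M[R]_m) (J2 : 'M[R]_(m, q))
    (P : 'M[R]_n) (Q : 'M[R]_(n, d * n)) :=
  (col_mx
     (col_mx (col_mx (row_mx P (0 : 'M[R]_(n, m)))
                (col_mx (row_mx (0 : 'M[R]_n) (0 : 'M[R]_(n, m)))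
                        (row_mx Q^T (0 : 'M[R]_(d * n, m)))))
             (row_mx (0 : 'M[R]_(q, n)) (- J2^T)))
     (row_mx (0 : 'M[R]_(m, n)) Jt) : 'M[R]_(chidim d n q + m, n + m))
  *m dsum (rowG cx) (rowG cz).

Definition bfH (K : 'M[R]_(p, n)) :=
  col_mx (bigH cx K) (bigH cz K)
    *m row_mx 1%:M (0 : 'M[R]_(chidim d n q, m)).

Definition main_lmi (r : R) (f : R -> 'cV[R]_d) (M : 'M[R]_d)
    (pl : plant R d n p m q) (K : 'M[R]_(p, n))
    (Jt J1 : 'M[R]_m) (J2 : 'M[R]_(m, q)) (J3 : 'M[R]_q)
    (P : 'M[R]_n) (Q : 'M[R]_(n, d * n)) (R0 : 'M[R]_(d * n)) (S U : 'M[R]_n)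
    (k2 : R) :=
  symblock3
    (Sy ((bfP P Q)^T *m bfPi pl K) + bfPhi r f M pl K Jt J1 J2 J3 Q R0 S U)
    (bfG Jt J2 P Q + k2 *: ((bfH K)^T *m bigJ2))
    (k2 *: (bfH K)^T)
    (k2 *: (FDelta^T *m bigJ2) + k2 *: (bigJ2^T *m FDelta) + k2 *: bigJ3)
    (k2 *: FDelta^T)
    (- (k2 *: bigJ1)).

End Lmi.

(* Main.v *)
Require Import Defs.
From HB Require Import structures.
From mathcomp Require Import all_boot all_order all_algebra.
From mathcomp Require Import all_classical all_reals all_analysis.
From mathcomp Require Import mxtens.
From mathcomp Require Import ring lra.

Set Implicit Arguments.
Unset Strict Implicit.
Unset Printing Implicit Defensive.

Import Order.TTheory GRing.Theory Num.Theory.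
Import numFieldNormedType.Exports.

Local Open Scope classical_set_scope.
Local Open Scope ring_scope.

(** The proof is a Krasovskii functional argument. With
    [eta = window_int r f phi], the integral of [F tau *m phi tau], the functional is
    [v phi = qform (block_mx P Q Q^T R0) (col_mx (phi 0) eta)] plus the integral over
    [-r <= tau <= 0] of [qform (S + (tau + r) *: U) (phi tau)].

    Matrix part. An admissible uncertainty acts as a feedback [u = Delta *m omega] with
    [omega = H *m chi + F *m u], and its constraint says that a quadratic form in
    [(omega, u)] is nonnegative. If the loop were singular, a nonzero [u] with [u = Delta F u]
    would make the form of the inequality with [k1] nonpositive; hence the inverses exist
    ([loop_unit]). The form of the inequality with [k2] is evaluated at the extended state
    [chi], at the loop signals [u], and at the values of the two remaining
    variables that undo the Schur complements for [J1] and for the [Xi_i]. The result is the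
    upper bound for the derivative of [v], minus the supply rate, plus [k2] times the
    nonnegative multiplier term. So the first two together are at most [- eps * |chi|^2]
    ([closed_loop_dissipation]); [eps] comes from the uniform positivity of a
    positive definite matrix ([posdef_coercive]).

    Analytic part. Since [f' = M f], the integral state [eta] is differentiable along any
    continuous trajectory, although the trajectory need not be
    ([is_derive_window], [deriv_on_window_int]), and so [v] is differentiable along
    the trajectory wherever the trajectory itself is ([deriv_on_lyapunov]). Bessel's
    inequality for [f], [window_int_bessel], is used twice: with [S] it gives
    [v phi >= c * |phi 0|^2], and with [U] it bounds the integral left in the derivative by a
    form in [eta]. As a bounded quadratic form on C([-r, 0]; R^n), [v] is Frechet
    differentiable and bounded by [C * |phi|^2] ([hist_quadratic_differentiable],
    [hist_quadratic_bounded]). Together with the matrix part this is dissipativity.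

    For zero input the supply rate is nonpositive, so [v] decreases along solutions at least
    at the rate [eps * |x|^2]. The two bounds on [v] give Lyapunov stability and boundedness; a
    bounded solution is Lipschitz, and if a coordinate were large at arbitrarily late times,
    [v] would lose a fixed amount each time and become negative ([solution_attracted]). *)

(** * Scalar products, quadratic forms and multiplier constraints *)

Section Dot.
Context (R : realType).

Definition dot (k : nat) (x y : 'cV[R]_k) : R := (x^T *m y) 0 0.

Lemma dotE (k : nat) (x y : 'cV[R]_k) : dot x y = \sum_i x i 0 * y i 0.
Proof. by rewrite /dot mxE; apply: eq_bigr => i _; rewrite mxE. Qed.

Lemma dotC (k : nat) (x y : 'cV[R]_k) : dot x y = dot y x.
Proof. by rewrite !dotE; apply: eq_bigr => i _; rewrite mulrC. Qed.

Lemma dotDl (k : nat) (x y z : 'cV[R]_k) : dot (x + y) z = dot x z + dot y z.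
Proof. by rewrite /dot linearD mulmxDl mxE. Qed.

Lemma dotDr (k : nat) (x y z : 'cV[R]_k) : dot x (y + z) = dot x y + dot x z.
Proof. by rewrite /dot mulmxDr mxE. Qed.

Lemma dotZl (k : nat) a (x y : 'cV[R]_k) : dot (a *: x) y = a * dot x y.
Proof. by rewrite /dot linearZ -scalemxAl mxE. Qed.

Lemma dotZr (k : nat) a (x y : 'cV[R]_k) : dot x (a *: y) = a * dot x y.
Proof. by rewrite dotC dotZl dotC. Qed.

Lemma dotNl (k : nat) (x y : 'cV[R]_k) : dot (- x) y = - dot x y.
Proof. by rewrite -scaleN1r dotZl mulN1r. Qed.

Lemma dotNr (k : nat) (x y : 'cV[R]_k) : dot x (- y) = - dot x y.
Proof. by rewrite -scaleN1r dotZr mulN1r. Qed.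

Lemma dot0l (k : nat) (y : 'cV[R]_k) : dot 0 y = 0.
Proof. by rewrite -(scale0r 0) dotZl mul0r. Qed.

Lemma dot0r (k : nat) (y : 'cV[R]_k) : dot y 0 = 0.
Proof. by rewrite dotC dot0l. Qed.

Lemma dot_mulmx (k l : nat) (A : 'M[R]_(k, l)) x y :
  dot (A *m x) y = dot x (A^T *m y).
Proof. by rewrite /dot trmx_mul mulmxA. Qed.

Lemma dot_col (k l : nat) (x x' : 'cV[R]_k) (y y' : 'cV[R]_l) :
  dot (col_mx x y) (col_mx x' y') = dot x x' + dot y y'.
Proof. by rewrite /dot tr_col_mx mul_row_col mxE. Qed.

Lemma dot_ge0 (k : nat) (x : 'cV[R]_k) : 0 <= dot x x.
Proof. by rewrite dotE sumr_ge0 // => i _; rewrite -expr2 sqr_ge0. Qed.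

Lemma sqr_coord_le_dot (k : nat) (x : 'cV[R]_k) i : x i 0 ^+ 2 <= dot x x.
Proof.
rewrite dotE (bigD1 i) //= -expr2 lerDl sumr_ge0 // => j _.
by rewrite -expr2 sqr_ge0.
Qed.

Lemma qformE (k : nat) (A : 'M[R]_k) x : qform A x = dot x (A *m x).
Proof. by rewrite /qform /dot mulmxA. Qed.

Lemma qform_sum (k : nat) (A : 'M[R]_k) x :
  qform A x = \sum_i \sum_j A i j * (x i 0 * x j 0).
Proof.
rewrite qformE dotE; apply: eq_bigr => i _; rewrite mxE mulr_sumr.
by apply: eq_bigr => j _; ring.
Qed.

Lemma qformD (k : nat) (A B : 'M[R]_k) x :
  qform (A + B) x = qform A x + qform B x.
Proof. by rewrite !qformE mulmxDl dotDr. Qed.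

Lemma qformN (k : nat) (A : 'M[R]_k) x : qform (- A) x = - qform A x.
Proof. by rewrite !qformE mulNmx dotNr. Qed.

Lemma qformZ (k : nat) c (A : 'M[R]_k) x : qform (c *: A) x = c * qform A x.
Proof. by rewrite !qformE -scalemxAl dotZr. Qed.

Lemma qform0 (k : nat) (A : 'M[R]_k) : qform A 0 = 0.
Proof. by rewrite qformE mulmx0 dot0r. Qed.

Lemma qform1 (k : nat) (x : 'cV[R]_k) : qform 1%:M x = dot x x.
Proof. by rewrite qformE mul1mx. Qed.

Lemma qform_Sy (k : nat) (A : 'M[R]_k) x : qform (Sy A) x = 2 * qform A x.
Proof.
rewrite qformD; suff -> : qform A^T x = qform A x by ring.
by rewrite !qformE -dot_mulmx dotC.
Qed.

Lemma qform_block (k l : nat) (A : 'M[R]_k) (B : 'M[R]_(k, l)) (C : 'M[R]_l) x y :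
  qform (block_mx A B B^T C) (col_mx x y) =
  qform A x + 2 * dot x (B *m y) + qform C y.
Proof.
rewrite !qformE mul_block_col dot_col !dotDr -dot_mulmx [dot (B *m y) x]dotC.
ring.
Qed.

Lemma qform_dsum (k l : nat) (A : 'M[R]_k) (C : 'M[R]_l) x y :
  qform (dsum A C) (col_mx x y) = qform A x + qform C y.
Proof. by rewrite !qformE mul_block_col !mul0mx addr0 add0r dot_col. Qed.

Lemma dsum_mulcol (k1 l1 k2 l2 : nat) (A : 'M[R]_(k1, l1)) (B : 'M[R]_(k2, l2))
  (x : 'cV[R]_l1) (y : 'cV[R]_l2) :
  dsum A B *m col_mx x y = col_mx (A *m x) (B *m y).
Proof. by rewrite mul_block_col !mul0mx addr0 add0r. Qed.

Lemma qform_symblock3 (k1 k2 k3 : nat)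
    (X11 : 'M[R]_k1) (X12 : 'M[R]_(k1, k2)) (X13 : 'M[R]_(k1, k3))
    (X22 : 'M[R]_k2) (X23 : 'M[R]_(k2, k3)) (X33 : 'M[R]_k3) a b c :
  qform (symblock3 X11 X12 X13 X22 X23 X33) (col_mx a (col_mx b c)) =
  qform X11 a + qform X22 b + qform X33 c
  + 2 * (dot a (X12 *m b) + dot a (X13 *m c) + dot b (X23 *m c)).
Proof. rewrite !qform_block mul_row_col dotDr; ring. Qed.

Lemma posdef_gt0 (k : nat) (A : 'M[R]_k) x : posdef A -> x != 0 -> 0 < qform A x.
Proof. by case=> _; apply. Qed.

Lemma posdef_ge0 (k : nat) (A : 'M[R]_k) x : posdef A -> 0 <= qform A x.
Proof.
move=> pA; have [->|x0] := eqVneq x 0; first by rewrite qform0.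
exact/ltW/posdef_gt0.
Qed.

Lemma posdef_unit (k : nat) (A : 'M[R]_k) : posdef A -> A \in unitmx.
Proof.
case=> sA pA; rewrite -row_free_unit -kermx_eq0.
apply/eqP/row_matrixP => i; rewrite row0.
have := sub_kermxP (row_sub i (kermx A)); set u := row i _ => uA.
have [//|u0] := eqVneq u 0.
have : 0 < qform A u^T by apply: pA; rewrite -trmx0 (inj_eq trmx_inj).
by rewrite /qform trmxK uA mul0mx mxE ltxx.
Qed.

(** The Cauchy-Schwarz inequality for the inner product of [A], applied to [x] and
    the column [e] of [A^-1], bounds each coordinate of [x] by a multiple of [qform A x]. *)
Lemma posdef_coercive (k : nat) (A : 'M[R]_k) : posdef A ->
  exists2 c : R, 0 < c & forall x, c * dot x x <= qform A x.
Proof.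
move=> pA; have uA := posdef_unit pA; have [sA _] := pA.
pose e i : 'cV[R]_k := invmx A *m delta_mx i 0.
pose T := \sum_i qform A (e i).
have T0 : 0 <= T by apply: sumr_ge0 => i _; exact: posdef_ge0.
have coord i (x : 'cV[R]_k) : x i 0 ^+ 2 <= qform A (e i) * qform A x.
  have xE : x i 0 = dot x (A *m e i).
    rewrite /e mulmxA mulmxV // mul1mx dotE (bigD1 i) //= big1 ?addr0 => [|j ji].
      by rewrite mxE !eqxx mulr1.
    by rewrite mxE (negbTE ji) mulr0.
  have poly (t : R) : 0 <= qform A x + 2 * t * x i 0 + t ^+ 2 * qform A (e i).
    have := posdef_ge0 (x + t *: e i) pA.
    rewrite qformE mulmxDr !dotDr !dotDl -!scalemxAr !dotZl !dotZr -!qformE.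
    have -> : dot (e i) (A *m x) = x i 0 by rewrite xE dotC dot_mulmx sA.
    rewrite -xE => H; apply: le_trans H _; lra.
  have ge0 := posdef_ge0 (e i) pA.
  have [q0|q0] := eqVneq (qform A (e i)) 0.
    have e0 : e i = 0.
      by apply/eqP/negPn/negP => /(posdef_gt0 pA); rewrite q0 ltxx.
    by rewrite q0 mul0r xE e0 mulmx0 dot0r expr0n.
  have qp : 0 < qform A (e i) by rewrite lt_def q0.
  have := poly (- x i 0 / qform A (e i)).
  have -> : qform A x + 2 * (- x i 0 / qform A (e i)) * x i 0
      + (- x i 0 / qform A (e i)) ^+ 2 * qform A (e i)
      = qform A x - x i 0 ^+ 2 / qform A (e i) by field.
  by rewrite subr_ge0 ler_pdivrMr // mulrC.
exists (1 + T)^-1; first by rewrite invr_gt0 ltr_pwDl.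
move=> x; rewrite mulrC ler_pdivrMr ?ltr_pwDl //.
have : dot x x <= T * qform A x.
  rewrite dotE /T mulr_suml; apply: ler_sum => i _; rewrite -expr2; exact: coord.
have := posdef_ge0 x pA; nra.
Qed.

End Dot.

Section Iqc.
Context (R : realType).

(** The quadratic constraint on one uncertainty block, with [Xi^-1 *m omega]
    written as a solution [s] of [Xi *m s = omega]: in this form it passes to
    block-diagonal sums without inverting a block-diagonal matrix. *)
Definition iqc (k l : nat) (Xi : 'M[R]_k) (L : 'M[R]_(k, l)) (G : 'M[R]_l)
    (D : 'M[R]_(l, k)) : Prop :=
  forall omega, exists2 s, Xi *m s = omega &
    0 <= dot omega s + 2 * dot omega (L *m (D *m omega)) + qform G (D *m omega).

Lemma iqc_admissible1 (g h : nat) (c : channel R g h) (D : 'M[R]_(dr c, dc c)) :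
  multiplier_ok c -> admissible1 D -> iqc (chXi c) (chLambda c) (chGamma c) D.
Proof.
move=> [pXi _] [_ adm] omega; have uXi := posdef_unit pXi.
exists (invmx (chXi c) *m omega); first by rewrite mulmxA mulmxV // mul1mx.
have := adm omega; set E := col_mx _ _.
rewrite [X in 0 <= X](_ : _ =
   qform (block_mx (invmx (chXi c)) (chLambda c) (chLambda c)^T (chGamma c))
     (E *m omega)); last by rewrite /qform trmx_mul !mulmxA.
by rewrite mul_col_mx mul1mx qform_block qformE.
Qed.

Lemma iqc_dsum (k1 l1 k2 l2 : nat) (Xi1 : 'M[R]_k1) L1 G1 (D1 : 'M[R]_(l1, k1))
    (Xi2 : 'M[R]_k2) L2 G2 (D2 : 'M[R]_(l2, k2)) :
  iqc Xi1 L1 G1 D1 -> iqc Xi2 L2 G2 D2 ->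
  iqc (dsum Xi1 Xi2) (dsum L1 L2) (dsum G1 G2) (dsum D1 D2).
Proof.
move=> i1 i2 omega; rewrite -[omega]vsubmxK.
have [s1 e1 h1] := i1 (usubmx omega); have [s2 e2 h2] := i2 (dsubmx omega).
exists (col_mx s1 s2); first by rewrite dsum_mulcol e1 e2.
by rewrite !dsum_mulcol !dot_col qform_dsum; lra.
Qed.

Lemma iqc_admissible (d n p q g : nat) (c : channels R d n p q g) (D : deltas c) :
  multipliers_ok c -> admissible D ->
  iqc (sumXi c) (sumLambda c) (sumGamma c) (sumDelta D).
Proof.
move=> [[? ? ? ?] [? ? ?]] [[? ? ? ?] [? ? ?]].
by do ?apply: iqc_dsum; apply: iqc_admissible1.
Qed.

Lemma dsum_mul (k1 l1 m1 k2 l2 m2 : nat) (A : 'M[R]_(k1, l1)) (B : 'M[R]_(l1, m1))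
   (A' : 'M[R]_(k2, l2)) (B' : 'M[R]_(l2, m2)) :
  dsum A A' *m dsum B B' = dsum (A *m B) (A' *m B').
Proof. by rewrite /dsum mulmx_block !mulmx0 !mul0mx !addr0 !add0r. Qed.

Lemma sumDeltaFE (d n p q g : nat) (c : channels R d n p q g) (D : deltas c) :
  sumDeltaF D = sumDelta D *m sumF c.
Proof. by rewrite /sumDeltaF /sumDelta /sumF /dsum7 !dsum_mul. Qed.

Lemma sub_dsum (k l : nat) (A : 'M[R]_k) (B : 'M[R]_l) :
  1%:M - dsum A B = dsum (1%:M - A) (1%:M - B).
Proof.
by rewrite /dsum scalar_mx_block opp_block_mx add_block_mx !oppr0 !addr0.
Qed.

Lemma dsum_unit (k l : nat) (A : 'M[R]_k) (B : 'M[R]_l) :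
  (dsum A B \in unitmx) = (A \in unitmx) && (B \in unitmx).
Proof. by rewrite !unitmxE det_ublock unitrM. Qed.

Lemma well_posed_sum (d n p q g : nat) (c : channels R d n p q g) (D : deltas c) :
  1%:M - sumDeltaF D \in unitmx -> well_posed D.
Proof.
rewrite /sumDeltaF /dsum7 !sub_dsum !dsum_unit /well_posed /well_posed1.
by move=> /andP[/andP[/andP[-> ->] /andP[/andP[-> ->] /andP[-> ->]]] ->].
Qed.

Lemma unitmx_of_injective (k : nat) (A : 'M[R]_k) :
  (forall x : 'cV[R]_k, A *m x = 0 -> x = 0) -> A \in unitmx.
Proof.
move=> inj; rewrite -unitmx_tr -row_free_unit -kermx_eq0.
apply/eqP/row_matrixP => i; rewrite row0.
have := sub_kermxP (row_sub i (kermx A^T)); set u := row i _ => uA.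
apply: trmx_inj; rewrite trmx0; apply: inj.
by rewrite -[A]trmxK -trmx_mul uA trmx0.
Qed.

End Iqc.

(** * The two matrix inequalities as quadratic forms *)

Section LmiConsequences.
Context (R : realType).

(** If [p = D F p], the multiplier constraint at [F p] and the form of the
    inequality at [(p, p, - Xi^-1 F p)] are the same number up to the factor [- k1]. *)
Lemma loop_unit (k l : nat) (Xi : 'M[R]_k) (L : 'M[R]_(k, l)) (G : 'M[R]_l)
    (D : 'M[R]_(l, k)) (F : 'M[R]_(k, l)) (k1 : R) :
  0 < k1 -> iqc Xi L G D ->
  posdef (symblock3 1%:M (- 1%:M - k1 *: (F^T *m L)) (k1 *: F^T)
    (1%:M - k1 *: G) 0 (k1 *: Xi)) ->
  1%:M - D *m F \in unitmx.
Proof.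
move=> k10 iq pd; apply: unitmx_of_injective => p /eqP.
rewrite mulmxBl mul1mx subr_eq0 => /eqP pE.
apply/eqP/negPn/negP => p0.
have DFp : D *m (F *m p) = p by rewrite mulmxA -pE.
have [s sE] := iq (F *m p); rewrite DFp => ge0.
have nz : col_mx p (col_mx p (- s)) != 0.
  by apply: contraNneq p0 => e; rewrite -[p](col_mxKu p (col_mx p (- s))) e linear0.
have := posdef_gt0 pd nz.
rewrite qform_symblock3 !qformD !qformN !qformZ !qform1 mulmxBl mulNmx mul1mx.
rewrite [qform Xi _]qformE -!scalemxAl mul0mx dot0r !dotDr !dotNr !dotZr.
rewrite !mulmxN sE !dotNr !dotNl -!mulmxA -!dot_mulmx [dot s _]dotC; nra.
Qed.

(** Each group of terms on the right has its own origin: the derivative of the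
    Lyapunov functional, the supply rate with [J1^-1] removed by the extra variable [y], and
    the multiplier constraint with [Xi^-1] removed by [s]. *)
Lemma main_lmi_qform (d n p m q : nat)
    (cx : channels R d n p q n) (cz : channels R d n p q m)
    (r : R) (f : R -> 'cV[R]_d) (M : 'M[R]_d)
    (pl : plant R d n p m q) (K : 'M[R]_(p, n))
    (Jt J1 : 'M[R]_m) (J2 : 'M[R]_(m, q)) (J3 : 'M[R]_q)
    (P : 'M[R]_n) (Q : 'M[R]_(n, d * n)) (R0 : 'M[R]_(d * n)) (S U : 'M[R]_n)
    (k2 : R) (x0 x1 : 'cV[R]_n) (eta : 'cV[R]_(d * n)) (w : 'cV[R]_q)
    (y : 'cV[R]_m) px pz s :
  P^T = P -> R0^T = R0 ->
  let c := col_mx (col_mx x0 (col_mx x1 eta)) w in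
  let u := col_mx px pz in
  let z := output_nom pl K *m c + rowG cz *m pz in
  let omega := col_mx (bigH cx K *m c) (bigH cz K *m c) + FDelta cx cz *m u in
  qform (main_lmi cx cz r f M pl K Jt J1 J2 J3 P Q R0 S U k2)
    (col_mx (col_mx c y) (col_mx u s)) =
  2 * dot (P *m x0 + Q *m eta) (state_nom pl K *m c + rowG cx *m px)
  + 2 * dot (Q^T *m x0 + R0 *m eta) (bfF n q r f M *m c)
  + qform (S + r *: U) x0 - qform S x1 - qform (Fgram r f *t U) eta
  + 2 * dot y (Jt *m z) + qform J1 y
  - 2 * dot w (J2^T *m z) - qform J3 w
  + k2 * (2 * dot omega (bigJ2 cx cz *m u) + qform (bigJ3 cx cz) u
          + 2 * dot omega s - qform (bigJ1 cx cz) s).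
Proof.
move=> sP sR c u z omega.
rewrite /main_lmi qform_symblock3 /bfPhi !(qform_Sy, qformD).
have -> : qform (dsum (dsum (dsum (S + r *: U) (dsum (- S) (- (Fgram r f *t U))))
                       (- J3)) J1) (col_mx c y) =
    qform S x0 + r * qform U x0 - qform S x1 - qform (Fgram r f *t U) eta
    - qform J3 w + qform J1 y.
  rewrite qform_dsum /c 3!qform_dsum qformD qformZ !qformN; ring.
move sE : (state_nom pl K *m c) => sc.
rewrite qformN !qformZ [(bfG _ _ _ _ _ _ + _) *m u]mulmxDl [dot (col_mx c y) (_ + _)]dotDr
  -!scalemxAl !dotZr.
have HE : bfH cx cz K *m col_mx c y = col_mx (bigH cx K *m c) (bigH cz K *m c).
  by rewrite /bfH -mulmxA mul_row_col mul1mx mul0mx addr0 mul_col_mx.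
have -> : qform ((bfP m q P Q)^T *m bfPi pl K) (col_mx c y) =
    dot (P *m x0 + Q *m eta) sc.
  rewrite -sE qformE -mulmxA -dot_mulmx /bfP /bfPi !mul_row_col.
  by rewrite !mul0mx !addr0 add0r.
have -> : qform (col_mx (col_mx (col_mx Q (col_mx (0 : 'M[R]_(n, d * n)) R0))
                     (0 : 'M[R]_(q, d * n)))
             (0 : 'M[R]_(m, d * n))
        *m row_mx (bfF n q r f M) (0 : 'M[R]_(d * n, m))) (col_mx c y) =
    dot (Q^T *m x0 + R0 *m eta) (bfF n q r f M *m c).
  rewrite qformE -mulmxA mul_row_col mul0mx addr0 !mul_col_mx !dot_col.
  by rewrite !mul0mx !dot0r !addr0 add0r dotDl !dot_mulmx trmxK sR.
have -> : qform (col_mx (col_mx (0 : 'M[R]_(n + (n + d * n), m)) (- J2^T)) Jt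
        *m row_mx (output_nom pl K) (0 : 'M[R]_m)) (col_mx c y) =
    dot y (Jt *m (output_nom pl K *m c)) - dot w (J2^T *m (output_nom pl K *m c)).
  rewrite qformE -mulmxA mul_row_col mul0mx addr0 !mul_col_mx !dot_col.
  by rewrite mul0mx dot0r mulNmx dotNr add0r addrC.
have -> : dot (col_mx c y) (bfG cx cz Jt J2 P Q *m u) =
    dot (P *m x0 + Q *m eta) (rowG cx *m px)
    + dot y (Jt *m (rowG cz *m pz)) - dot w (J2^T *m (rowG cz *m pz)).
  rewrite /bfG -mulmxA dsum_mulcol !mul_col_mx !dot_col !mul_row_col !mul0mx.
  rewrite !addr0 !add0r dot0r mulNmx dotNr dotDl !dot_mulmx sP; ring.
have -> : dot (col_mx c y) ((bfH cx cz K)^T *m bigJ2 cx cz *m u) =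
    dot (col_mx (bigH cx K *m c) (bigH cz K *m c)) (bigJ2 cx cz *m u).
  by rewrite -mulmxA -dot_mulmx HE.
have -> : dot (col_mx c y) ((bfH cx cz K)^T *m s) =
    dot (col_mx (bigH cx K *m c) (bigH cz K *m c)) s.
  by rewrite -dot_mulmx HE.
have -> : qform ((FDelta cx cz)^T *m bigJ2 cx cz) u =
    dot (FDelta cx cz *m u) (bigJ2 cx cz *m u).
  by rewrite qformE -mulmxA -dot_mulmx.
have -> : qform ((bigJ2 cx cz)^T *m FDelta cx cz) u =
    dot (FDelta cx cz *m u) (bigJ2 cx cz *m u).
  by rewrite qformE -mulmxA -dot_mulmx dotC.
have -> : dot u ((FDelta cx cz)^T *m s) = dot (FDelta cx cz *m u) s.
  by rewrite -dot_mulmx.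
rewrite /omega /z !mulmxDr !dotDr !dotDl; ring.
Qed.

End LmiConsequences.

(** * Well-posedness and pointwise dissipation *)

Section ClosedLoop.
Context (R : realType) (d n p m q : nat).
Context (cx : channels R d n p q n) (cz : channels R d n p q m).
Context (Dx : deltas cx) (Dz : deltas cz).

(** The uncertainty is pulled out of the loop: [u] is the signal it feeds back, and in terms
    of [u] the perturbed coefficients act linearly, without any inverse. *)
Lemma perturbation_loop (g : nat) (c : channels R d n p q g) (D : deltas c)
    (K : 'M[R]_(p, n)) (v : 'cV[R]_(chidim d n q)) :
  1%:M - sumDeltaF D \in unitmx ->
  exists2 u, perturbation D K *m v = rowG c *m u &
    u = sumDelta D *m (bigH c K *m v + sumF c *m u).
Proof.
move=> uD; exists (invmx (1%:M - sumDeltaF D) *m (sumDelta D *m (bigH c K *m v))).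
  by rewrite /perturbation -!mulmxA.
set h := bigH c K *m v; set u := invmx _ *m _.
have : (1%:M - sumDeltaF D) *m u = sumDelta D *m h.
  by rewrite /u mulmxA mulmxV // mul1mx.
rewrite mulmxBl mul1mx sumDeltaFE mulmxDr => /eqP.
by rewrite subr_eq -mulmxA => /eqP.
Qed.

Hypothesis (cx_ok : multipliers_ok cx) (cz_ok : multipliers_ok cz).
Hypothesis (Dx_adm : admissible Dx) (Dz_adm : admissible Dz).

Let iqcD : iqc (bigJ1 cx cz) (bigJ2 cx cz) (bigJ3 cx cz)
  (dsum (sumDelta Dx) (sumDelta Dz)).
Proof. by apply: iqc_dsum; apply: iqc_admissible. Qed.

Variables (k1 : R) (k1_gt0 : 0 < k1) (lmi1 : posdef (well_posed_lmi cx cz k1)).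

Lemma loops_unit :
  1%:M - sumDeltaF Dx \in unitmx /\ 1%:M - sumDeltaF Dz \in unitmx.
Proof.
have := loop_unit k1_gt0 iqcD lmi1.
by rewrite /FDelta dsum_mul sub_dsum dsum_unit -!sumDeltaFE => /andP.
Qed.

Variables (r : R) (f : R -> 'cV[R]_d) (M : 'M[R]_d) (pl : plant R d n p m q).
Variables (K : 'M[R]_(p, n)) (Jt J1 : 'M[R]_m) (J2 : 'M[R]_(m, q)) (J3 : 'M[R]_q).
Variables (P : 'M[R]_n) (Q : 'M[R]_(n, d * n)) (R0 : 'M[R]_(d * n)).
Variables (S U : 'M[R]_n) (k2 : R).
Hypothesis (J1_unit : J1 \in unitmx).
Hypothesis (P_sym : P^T = P) (R0_sym : R0^T = R0) (k2_gt0 : 0 < k2).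
Hypothesis lmi2 :
  negdef (main_lmi cx cz r f M pl K Jt J1 J2 J3 P Q R0 S U k2).

(** The matrix inequality is evaluated at the point where the extra variables take
    the values [y = - J1^-1 Jt z], the loop signals [u], and [s = bigJ1^-1 omega];
    the multiplier term is then nonnegative and can be dropped. *)
Lemma closed_loop_dissipation : exists2 eps : R, 0 < eps &
  forall (x0 x1 : 'cV[R]_n) (eta : 'cV[R]_(d * n)) (w : 'cV[R]_q) c,
  c = col_mx (col_mx x0 (col_mx x1 eta)) w ->
  2 * dot (P *m x0 + Q *m eta) (state_mx pl Dx K *m c)
  + 2 * dot (Q^T *m x0 + R0 *m eta) (bfF n q r f M *m c)
  + qform (S + r *: U) x0 - qform S x1 - qform (Fgram r f *t U) eta
  - supply Jt J1 J2 J3 (output_mx pl Dz K *m c) w <= - (eps * dot c c).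
Proof.
have [eps eps0 coer] := posdef_coercive lmi2; exists eps => // x0 x1 eta w c cE.
have [ux uz] := loops_unit.
have [px pxG pxE] := perturbation_loop K c ux.
have [pz pzG pzE] := perturbation_loop K c uz.
pose omega := col_mx (bigH cx K *m c) (bigH cz K *m c)
  + FDelta cx cz *m col_mx px pz.
have uE : dsum (sumDelta Dx) (sumDelta Dz) *m omega = col_mx px pz.
  by rewrite /omega dsum_mulcol add_col_mx dsum_mulcol -pxE -pzE.
have [s sE] := iqcD omega; rewrite uE => ge0.
pose z := output_nom pl K *m c + rowG cz *m pz.
have zE : output_mx pl Dz K *m c = z by rewrite /output_mx mulmxDl pzG.
pose y : 'cV[R]_m := - (invmx J1 *m (Jt *m z)).
have := coer (col_mx (col_mx c y) (col_mx (col_mx px pz) s)).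
rewrite qformN [in qform _ _]cE main_lmi_qform // -cE -/omega -/z !dot_col.
have -> : state_mx pl Dx K *m c = state_nom pl K *m c + rowG cx *m px.
  by rewrite /state_mx mulmxDl pxG.
rewrite zE /supply qform_block.
have -> : qform (Jt^T *m invmx J1 *m Jt) z = - dot y (Jt *m z).
  by rewrite qformE -!mulmxA -dot_mulmx /y dotNl opprK dotC.
have -> : qform J1 y = - dot y (Jt *m z).
  by rewrite qformE {2}/y mulmxN mulmxA mulmxV // mul1mx dotNr.
have -> : dot w (J2^T *m z) = dot z (J2 *m w).
  by rewrite -dot_mulmx dotC.
have -> : qform (bigJ1 cx cz) s = dot omega s by rewrite qformE sE dotC.
have := mulr_ge0 (ltW k2_gt0) ge0.
have := mulr_ge0 (ltW eps0) (dot_ge0 y).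
have := mulr_ge0 (ltW eps0) (dot_ge0 px).
have := mulr_ge0 (ltW eps0) (dot_ge0 pz).
have := mulr_ge0 (ltW eps0) (dot_ge0 s).
lra.
Qed.

End ClosedLoop.

(** * Derivatives relative to a set *)

Section DerivOn.
Context (R : realType).
Implicit Types (D : set R) (g : R -> R^o).

Let dfilter D (t : R) := within [set h | D (t + h)] (0 : R)^'.

Lemma deriv_on_cvg D g t l : deriv_on D g t l ->
  g (t + h) @[h --> dfilter D t] --> g t.
Proof.
move=> dg.
have dg' : (h * (h^-1 *: (g (t + h) - g t)) + g t : R)
    @[h --> dfilter D t] --> (0 * l + g t : R).
  apply: cvgD; last exact: cvg_cst.
  apply: cvgM; last exact: dg.
  apply: cvg_within_filter; exact: cvg_within_filter.
rewrite mul0r add0r in dg'.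
apply: cvg_trans dg'; apply: near_eq_cvg; rewrite /dfilter near_withinE.
near=> h => _.
have h0 : h != 0 by near: h; exact: nbhs_dnbhs_neq.
by rewrite /GRing.scale /= mulrA divff // mul1r subrK.
Unshelve. all: by end_near. Qed.

Lemma deriv_on_cst D (c : R) t : deriv_on D (fun=> c : R^o) t 0.
Proof.
rewrite /deriv_on; under eq_fun do rewrite subrr scaler0.
exact: cvg_cst.
Qed.

Lemma deriv_onD D g1 g2 t l1 l2 : deriv_on D g1 t l1 -> deriv_on D g2 t l2 ->
  deriv_on D (fun s => g1 s + g2 s) t (l1 + l2).
Proof.
move=> d1 d2; apply: cvg_trans (cvgD d1 d2); apply: near_eq_cvg.
by near=> h; rewrite fctE /GRing.scale /=; ring.
Unshelve. all: by end_near. Qed.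

Lemma deriv_onM D g1 g2 t l1 l2 : deriv_on D g1 t l1 -> deriv_on D g2 t l2 ->
  deriv_on D (fun s => g1 s * g2 s) t (l1 * g2 t + g1 t * l2).
Proof.
move=> d1 d2; have c2 := deriv_on_cvg d2.
apply: cvg_trans (cvgD (cvgM d1 c2) (cvgM (cvg_cst (g1 t)) d2)).
apply: near_eq_cvg.
by near=> h; rewrite !fctE /GRing.scale /=; ring.
Unshelve. all: by end_near. Qed.

Lemma deriv_onZ D g t l (c : R) : deriv_on D g t l ->
  deriv_on D (fun s => c * g s) t (c * l).
Proof.
move=> dg; have := deriv_onM (deriv_on_cst D c t) dg.
by rewrite mul0r add0r.
Qed.

Lemma deriv_on_sum (I : finType) D (g : I -> R -> R^o) t (l : I -> R) :
  (forall i, deriv_on D (g i) t (l i)) ->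
  deriv_on D (fun s => \sum_i g i s) t (\sum_i l i).
Proof.
move=> dg; rewrite [X in deriv_on _ X](_ : _ = \sum_i g i); last first.
  by apply/funext => s; rewrite fct_sumE.
elim/big_ind2 : _ => // [|g1 l1 g2 l2]; first exact: deriv_on_cst.
exact: deriv_onD.
Qed.

Lemma eq_deriv_on (V : normedModType R) D (g1 g2 : R -> V) t l :
  D t -> (forall s, D s -> g1 s = g2 s) ->
  deriv_on D g1 t l -> deriv_on D g2 t l.
Proof.
move=> Dt e; apply: cvg_trans; apply: near_eq_cvg.
by rewrite near_withinE; near=> h => Dh; rewrite !e.
Unshelve. all: by end_near. Qed.

Lemma eq_deriv_on_all (V : normedModType R) D (g1 g2 : R -> V) t l :
  g1 =1 g2 -> deriv_on D g1 t l -> deriv_on D g2 t l.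
Proof. by move/funext->. Qed.

Lemma is_derive_deriv_on D g (t l : R) : is_derive t 1 (g : R -> R) l -> deriv_on D g t l.
Proof.
move=> [dg <-]; apply: cvg_within_filter.
move: dg; rewrite /derivable /derive => /cvg_ex[l' dl].
rewrite (cvg_lim _ dl) //; apply: cvg_trans dl; apply: near_eq_cvg.
by near=> h; rewrite /= [h *: 1]mulr1 [h + t]addrC.
Unshelve. all: by end_near. Qed.

Lemma deriv_on_is_derive D g (t l : R) : nbhs t D ->
  deriv_on D g t l -> is_derive t 1 (g : R -> R) l.
Proof.
move=> nD dg.
have lim : h^-1 *: (g (h *: 1 + t) - g t) @[h --> (0 : R)^'] --> l.
  move=> A /dg; rewrite /nbhs /= /within /= => W.
  have Dh : \forall h \near (0 : R)^', D (t + h).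
    have : (t + h) @[h --> (0 : R)^'] --> t + 0.
      by apply: cvgD; [exact: cvg_cst | exact: cvg_within_filter].
    by rewrite addr0 => /(_ _ nD).
  near=> h; rewrite /= [h *: 1]mulr1 [h + t]addrC.
  by apply: (near W h) => //; near: h.
split; first by apply/cvg_ex; exists l.
exact: cvg_lim lim.
Unshelve. all: by end_near. Qed.

Lemma deriv_on_coord D (m k : nat) (g : R -> 'M[R]_(m, k)) t l i j :
  deriv_on D g t l -> deriv_on D (fun s => g s i j : R^o) t (l i j).
Proof.
move=> dg; apply: cvg_trans (continuous_cvg _ (@coord_continuous R m k i j l) dg).
by apply: near_eq_cvg; near=> h; rewrite /= !mxE.
Unshelve. all: by end_near. Qed.

Lemma cvg_mx_coord (T : Type) (F : set_system T) (m k : nat) (g : T -> 'M[R]_(m, k))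
    (l : 'M[R]_(m, k)) : Filter F ->
  (forall i j, g x i j @[x --> F] --> l i j) -> g x @[x --> F] --> l.
Proof.
move=> FF cg A [P Pl PA].
have : \forall x \near F, forall i j, P i j (g x i j).
  by apply: filter_forall => i; apply: filter_forall => j; exact: (cg i j _ (Pl i j)).
by apply: filterS => x Px; apply: PA.
Qed.

Lemma deriv_on_mx D (m k : nat) (g : R -> 'M[R]_(m, k)) t (l : 'M[R]_(m, k)) :
  (forall i j, deriv_on D (fun s => g s i j : R^o) t (l i j)) -> deriv_on D g t l.
Proof.
move=> dg; apply: cvg_mx_coord => i j; apply: cvg_trans (dg i j).
by apply: near_eq_cvg; near=> h; rewrite /= !mxE.
Unshelve. all: by end_near. Qed.

Lemma deriv_on_within D g t l : deriv_on D g t l -> g @ within D (nbhs t) --> g t.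
Proof.
move=> /deriv_on_cvg cg A An; have := cg A An.
rewrite /nbhs /= /dfilter /within /= /dnbhs /within /= => /nbhs_ballP[e /= e0 eA].
apply/nbhs_ballP; exists e => //= s ts Ds.
have [->|st] := eqVneq s t; first exact: nbhs_singleton.
have E : t + (s - t) = s by rewrite addrC subrK.
rewrite -E; apply: eA; rewrite /= ?E ?subr_eq0 //.
by move: ts; rewrite /ball /= sub0r opprB.
Qed.

Lemma nbhs_halfline (a t : R) : a < t -> nbhs t `[a, +oo[%classic.
Proof.
move=> at_; apply: (@filterS _ _ _ `]a, +oo[%classic).
  by move=> s /=; rewrite !in_itv /= !andbT => /ltW.
by apply: open_nbhs_nbhs; split; [exact: interval_open | by rewrite /= in_itv /= at_].
Qed.

(** A one-sided derivative at the end point [t0] suffices, since the mean value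
    theorem only differentiates in the interior. *)
Lemma deriv_on_le_growth (t0 : R) g (dg : R -> R) (a b c : R) :
  t0 <= a -> a <= b ->
  (forall t, t0 <= t -> deriv_on `[t0, +oo[ g t (dg t)) ->
  (forall t, a <= t <= b -> dg t <= c) ->
  g b - g a <= c * (b - a).
Proof.
move=> t0a ab dgP dgle.
have cont : {within `[a, b], continuous (g : R -> R)}.
  apply/subspace_continuousP => t /=; rewrite in_itv /= => /andP[at_ tb].
  apply: cvg_trans (deriv_on_within (dgP t (le_trans t0a at_))).
  apply: cvg_app; apply: within_subset => s /=; rewrite !in_itv /= andbT.
  by move=> /andP[as_ _]; exact: le_trans as_.
have der (s : R) : s \in `]a, b[ -> is_derive s 1 (g : R -> R) (dg s).
  rewrite in_itv /= => /andP[as_ _]; have t0s := le_lt_trans t0a as_.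
  by apply: (deriv_on_is_derive (nbhs_halfline t0s)); exact/dgP/ltW.
have [s sab ->] := MVT_segment ab der cont.
by apply: ler_wpM2r; [rewrite subr_ge0 | apply: dgle; move: sab; rewrite in_itv].
Qed.

End DerivOn.

(** * Integrals of continuous functions and moving windows *)

Section ContinuousIntegral.
Context (R : realType).
Notation mu := (@lebesgue_measure R).
Implicit Types (g : R -> R) (a b c : R).

Lemma eq_within_continuous (D : set R) g1 g2 : g1 =1 g2 ->
  {within D, continuous g2} -> {within D, continuous g1}.
Proof. by move/funext->. Qed.

Lemma within_continuousD (D : set R) g1 g2 : {within D, continuous g1} ->
  {within D, continuous g2} -> {within D, continuous (fun t => g1 t + g2 t)}.
Proof. by move=> c1 c2 t; apply: cvgD; [exact: c1 | exact: c2]. Qed.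

Lemma within_continuousM (D : set R) g1 g2 : {within D, continuous g1} ->
  {within D, continuous g2} -> {within D, continuous (fun t => g1 t * g2 t)}.
Proof. by move=> c1 c2 t; apply: cvgM; [exact: c1 | exact: c2]. Qed.

Lemma within_continuous_cst (D : set R) c : {within D, continuous (fun=> c : R)}.
Proof. by move=> t; exact: cvg_cst. Qed.

Lemma within_continuous_sum (D : set R) (I : finType) (g : I -> R -> R) :
  (forall i, {within D, continuous (g i)}) ->
  {within D, continuous (fun t => \sum_i g i t)}.
Proof.
move=> cg; rewrite (_ : (fun t => _) = \sum_i g i); last first.
  by apply/funext => t; rewrite fct_sumE.
elim/big_ind : _ => // [|g1 g2]; first exact: within_continuous_cst.
exact: within_continuousD.
Qed.

Lemma continuous_within (D : set R) g : continuous g -> {within D, continuous g}.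
Proof. exact: continuous_subspaceT. Qed.

Lemma continuous_integrable a b g : {within `[a, b], continuous g} ->
  mu.-integrable `[a, b] (EFin \o g).
Proof. by move=> cg; apply: continuous_compact_integrable => //; exact: segment_compact. Qed.

Section Segment.
Variables (a b : R).
Local Notation int g := (\int[mu]_(t in `[a, b]) g t).

Lemma intD g1 g2 : {within `[a, b], continuous g1} -> {within `[a, b], continuous g2} ->
  int (fun t => g1 t + g2 t) = int g1 + int g2.
Proof. by move=> c1 c2; rewrite RintegralD //; exact: continuous_integrable. Qed.

Lemma intZ c g : {within `[a, b], continuous g} ->
  int (fun t => c * g t) = c * int g.
Proof. by move=> cg; rewrite RintegralZl //; exact: continuous_integrable. Qed.

Lemma int0 : int (fun=> 0) = 0.
Proof. by rewrite Rintegral_cst // mul0r. Qed.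

Lemma int_sum (I : finType) (g : I -> R -> R) :
  (forall i, {within `[a, b], continuous (g i)}) ->
  int (fun t => \sum_i g i t) = \sum_i int (g i).
Proof.
move=> cg.
suff H (s : seq I) : {within `[a, b], continuous (fun t => \sum_(i <- s) g i t)} /\
    int (fun t => \sum_(i <- s) g i t) = \sum_(i <- s) int (g i).
  by have [_] := H (index_enum I).
elim: s => [|i s [IHc IH]].
  split; last by under eq_Rintegral do rewrite big_nil; rewrite big_nil int0.
  by under [X in {within _, continuous X}]eq_fun do rewrite big_nil;
    exact: within_continuous_cst.
split.
  by under [X in {within _, continuous X}]eq_fun do rewrite big_cons;
    exact: within_continuousD.
by under eq_Rintegral do rewrite big_cons; rewrite big_cons intD // IH.
Qed.

Lemma int_norm_le c g : a <= b -> {within `[a, b], continuous g} ->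
  (forall t, a <= t <= b -> `|g t| <= c) -> `|int g| <= c * (b - a).
Proof.
move=> ab cg gc; apply: le_trans.
  by apply: le_normr_Rintegral => //; exact: continuous_integrable.
have -> : c * (b - a) = int (fun=> c).
  rewrite Rintegral_cst //= lebesgue_measure_itv /= lte_fin.
  by case: ltgtP ab => //= -> _; rewrite subrr.
apply: le_Rintegral => //.
- have := continuous_integrable cg; move/integrable_norm.
  by apply: eq_integrable.
- exact/continuous_integrable/within_continuous_cst.
Qed.

End Segment.

(** The case distinction on the sign turns the Lebesgue integral over a segment into an
    oriented one, so that a single primitive serves all base points. *)
Lemma primitive_exists g : continuous g ->
  exists Y : R -> R, (forall t : R, is_derive t 1 Y (g t)) /\
    forall a b, a <= b -> \int[mu]_(t in `[a, b]) g t = Y b - Y a.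
Proof.
move=> cg.
have ci a b : mu.-integrable `[a, b] (EFin \o g).
  exact/continuous_integrable/continuous_within.
have split3 a b c : a <= b -> b <= c ->
    \int[mu]_(t in `[a, c]) g t = \int[mu]_(t in `[a, b]) g t + \int[mu]_(t in `[b, c]) g t.
  move=> ab bc; have := @Rintegral_itvB R g (BLeft a) (BRight c) b (ci a c).
  rewrite !bnd_simp => /(_ ab bc) e.
  have e' := @Rintegral_itv_obnd_cbnd R b (BRight c) g.
  rewrite -e' -?e; first by rewrite addrC subrK.
  by apply: integrableS (ci b c) => //; apply: subset_itvr; rewrite bnd_simp.
pose Y t := if 0 <= t then \int[mu]_(s in `[0, t]) g s else - \int[mu]_(s in `[t, 0]) g s.
have YE a b : a <= b -> \int[mu]_(t in `[a, b]) g t = Y b - Y a.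
  move=> ab; rewrite /Y; have [a0|a0] := leP 0 a.
    by rewrite (le_trans a0 ab) (split3 0 a b) // [X in X - _]addrC addrK.
  have [b0|b0] := leP 0 b; first by rewrite (split3 a 0 b) // ?(ltW a0) //; ring.
  by rewrite (split3 a b 0) // ?(ltW b0) //; ring.
exists Y; split => // t.
have tm : t - 1 < t by rewrite ltrBlDr ltrDl.
have tp : t < t + 1 by rewrite ltrDl.
have [dF dFE] := @continuous_FTC1_closed R g (t - 1) t (t + 1) tp (ci _ _) tm (cg t).
set F := fun y => _ in dF dFE.
have YF : {near t, F + cst (Y (t - 1)) =1 Y}.
  near=> s; rewrite fctE /F YE ?subrK //.
  by apply/ltW; near: s; exact: lt_nbhsr.
have dFt : is_derive t 1 F (g t) by split; rewrite // -derive1E.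
have := is_deriveD dFt (is_derive_cst (Y (t - 1)) t 1).
by rewrite addr0; exact: near_eq_is_derive.
Unshelve. all: by end_near. Qed.

Lemma within_continuous_bounded a b g : a <= b -> {within `[a, b], continuous g} ->
  exists2 c, 0 <= c & forall t, a <= t <= b -> `|g t| <= c.
Proof.
move=> ab cg; have cn : {within `[a, b], continuous (fun t => `|g t|)}.
  by move=> t; apply: cvg_norm; exact: cg.
have [c _ cmax] := EVT_max ab cn.
by exists `|g c| => // t tab; apply: cmax; rewrite in_itv.
Qed.

Lemma deriv_on_segment a b g (dg : R -> R) : a < b ->
  (forall t, t \in `[a, b] -> deriv_on `[a, b] (g : R -> R^o) t (dg t)) ->
  [/\ {within `[a, b], continuous g}, derivable_oo_LRcontinuous g a b &
      {in `]a, b[, derive1 g =1 dg}].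
Proof.
move=> ab gP.
have cg : {within `[a, b], continuous g}.
  by apply/subspace_continuousP => t tab; apply: deriv_on_within (gP t tab).
have der t : t \in `]a, b[ -> is_derive t 1 g (dg t).
  move=> tab; apply: deriv_on_is_derive (gP t _); last exact: subset_itv_oo_cc.
  apply: (@filterS _ _ _ `]a, b[%classic); first exact: subset_itv_oo_cc.
  by apply: open_nbhs_nbhs; split; [exact: interval_open | ].
split => //.
- have /(continuous_within_itvP _ ab)[_ ga gb] := cg.
  by split => // t /der[].
- by move=> t /der[_ <-]; rewrite derive1E.
Qed.

Section Leibniz.
Variables (r : R) (a a' y : R -> R).
Hypotheses (r_gt0 : 0 < r) (ca' : {within `[- r, 0], continuous a'}).
Hypothesis (da : forall t, t \in `[- r, 0] -> deriv_on `[- r, 0] (a : R -> R^o) t (a' t)).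
Hypothesis (cy : continuous y).

Let r0 : - r < 0. Proof. by rewrite oppr_lt0. Qed.

Let shift_continuous (z : R -> R) s : continuous z -> continuous (fun t => z (s + t)).
Proof.
move=> cz t; apply: continuous_comp (cz _).
by apply: cvgD; [exact: cvg_cst | exact: cvg_id].
Qed.

(** Differentiation of a weighted integral over a moving window. After an
    integration by parts the window is filled with a primitive [Y] of [y], which can be
    differentiated under the integral sign although [y] is only continuous. *)
Lemma is_derive_window (s : R) :
  is_derive s 1 (fun s => \int[mu]_(t in `[- r, 0]) (a t * y (s + t)))
    (a 0 * y s - a (- r) * y (s - r)
     - \int[mu]_(t in `[- r, 0]) (a' t * y (s + t))).
Proof.
have [Y [dY _]] := primitive_exists cy.
have cY : continuous Y.
  by move=> t; apply: differentiable_continuous; apply/derivable1_diffP; case: (dY t).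
have [ca da1 da2] := deriv_on_segment r0 da.
have dYs (u t : R) : is_derive t 1 (fun t => Y (u + t)) (y (u + t)).
  have dsh : is_derive t 1 (fun t : R => u + t) 1.
    by rewrite -[X in is_derive _ _ _ X]add0r; apply: is_deriveD.
  by have := @is_derive1_comp R Y (fun t => u + t) t _ _ (dY (u + t)) dsh; rewrite mulr1.
have parts u : \int[mu]_(t in `[- r, 0]) (a t * y (u + t)) =
    a 0 * Y u - a (- r) * Y (u - r) - \int[mu]_(t in `[- r, 0]) (a' t * Y (u + t)).
  rewrite (@Rintegration_by_parts R a (fun t => Y (u + t)) a') ?addr0 //.
  - exact/continuous_within/shift_continuous.
  - split.
    + by move=> t _; case: (dYs u t).
    + by have := @shift_continuous Y u cY (- r); exact: cvg_at_right_filter.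
    + by have := @shift_continuous Y u cY 0; exact: cvg_at_left_filter.
  - by move=> t _; have [_] := dYs u t; rewrite derive1E.
have -> : (fun s => \int[mu]_(t in `[- r, 0]) (a t * y (s + t))) =
    (fun u => a 0 * Y u - a (- r) * Y (u - r)) +
    - (fun u => \int[mu]_(t in `[- r, 0]) (a' t * Y (u + t))).
  by apply/funext => u; rewrite parts.
have win : is_derive s 1 (fun u => \int[mu]_(t in `[- r, 0]) (a' t * Y (u + t)))
    (\int[mu]_(t in `[- r, 0]) (a' t * y (s + t))).
  pose F (u t : R) := a' t * Y (u + t).
  have [ca0 ca0_ge0 ca0P] := within_continuous_bounded (ltW r0) ca'.
  have ab : s - 1 - r <= s + 1 by move: r_gt0; lra.
  have [cy0 cy0_ge0 cy0P] := within_continuous_bounded ab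
    (continuous_within (D := `[s - 1 - r, s + 1]%classic) cy).
  have dF (u t : R) : is_derive u 1 (F ^~ t) (a' t * y (u + t)).
    rewrite /F; under eq_fun do rewrite addrC.
    by rewrite [u + t]addrC; exact: is_deriveZ.
  have dFE u t : partial1of2 F u t = a' t * y (u + t).
    by rewrite /partial1of2 derive1E; have [_] := dF u t.
  have sI : `]s - 1, s + 1[%classic s by rewrite /= in_itv /=; apply/andP; split; lra.
  have iF (u : R) : `]s - 1, s + 1[%classic u -> mu.-integrable `[- r, 0] (EFin \o F u).
    move=> _; apply: continuous_integrable; apply: within_continuousM => //.
    exact/continuous_within/shift_continuous.
  have dFI (u t : R) : `]s - 1, s + 1[%classic u -> `[- r, 0]%classic t ->
    derivable (F ^~ t) u 1 by move=> _ _; case: (dF u t).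
  have bd (u t : R) : `]s - 1, s + 1[%classic u -> `[- r, 0]%classic t ->
      `|partial1of2 F u t| <= ca0 * cy0.
    rewrite /= !in_itv /= => /andP[u1 u2] /andP[t1 t2]; rewrite dFE normrM.
    by apply: ler_pM => //; [apply: ca0P|apply: cy0P]; apply/andP; split;
      move: u1 u2 t1 t2 r_gt0; lra.
  have ic : mu.-integrable `[- r, 0] (EFin \o (fun=> ca0 * cy0)).
    exact/continuous_integrable/within_continuous_cst.
  have mI : @measurable _ (measurableTypeR R) `[- r, 0]%classic by [].
  have c_ge0 (t : R) : 0 <= (fun=> ca0 * cy0) t by rewrite mulr_ge0.
  split; first exact: (derivable_under_integral mI sI iF dFI c_ge0 ic bd).
  rewrite -derive1E (differentiation_under_integral mI sI iF dFI c_ge0 ic bd).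
  by apply: eq_Rintegral => t _; rewrite dFE.
have d0 : is_derive s 1 (fun u => a 0 * Y u) (a 0 * y s) by exact: is_deriveZ.
have d1 : is_derive s 1 (fun u => a (- r) * Y (u - r)) (a (- r) * y (s - r)).
  have := dYs (- r) s; rewrite [- r + s]addrC; under eq_fun do rewrite addrC.
  by move=> dYr; exact: is_deriveZ.
exact: is_deriveB (is_deriveB d0 d1) win.
Qed.

End Leibniz.

End ContinuousIntegral.

(** * Kronecker-weighted integrals and Bessel's inequality *)

Section Kronecker.
Context (R : realType).

Lemma sum_mxtens_index (d n : nat) (g : 'I_(d * n) -> R) :
  \sum_k g k = \sum_i \sum_j g (mxtens_index (i, j)).
Proof.
rewrite pair_big /= (reindex (@mxtens_index d n)) /=; last first.
  exists (@mxtens_unindex d n) => k _; [exact: mxtens_indexK | exact: mxtens_unindexK].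
by apply: eq_bigr => -[i j].
Qed.

Lemma FkronE (d n : nat) (f : R -> 'cV[R]_d) tau k j :
  Fkron n f tau k j =
  f tau (mxtens_unindex k).1 0 * ((mxtens_unindex k).2 == j)%:R.
Proof.
rewrite /Fkron castmxE [LHS]mxE [X in _ * X]mxE.
have -> : cast_ord (esym (erefl (d * n)%N)) k = k by exact: val_inj.
rewrite [(mxtens_unindex (cast_ord _ j)).1]ord1; congr (_ * (_ == _)%:R).
by apply: val_inj; rewrite /= modn_small.
Qed.

Lemma Fkron_mulE (d n l : nat) (f : R -> 'cV[R]_d) tau (u : 'M[R]_(n, l)) k j :
  (Fkron n f tau *m u) k j =
  f tau (mxtens_unindex k).1 0 * u (mxtens_unindex k).2 j.
Proof.
rewrite mxE (bigD1 (mxtens_unindex k).2) //= FkronE eqxx mulr1 big1 ?addr0 //.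
by move=> i ik; rewrite FkronE eq_sym (negbTE ik) mulr0 mul0r.
Qed.

Lemma tens_Fkron (d n : nat) (f : R -> 'cV[R]_d) (N : 'M[R]_d) (S : 'M[R]_n) tau
  (u : 'cV[R]_n) :
  (N *t S) *m (Fkron n f tau *m u) = Fkron n (fun t => N *m f t) tau *m (S *m u).
Proof.
apply/colP => k; rewrite Fkron_mulE !mxE sum_mxtens_index mulr_suml.
apply: eq_bigr => i _; rewrite mulr_sumr; apply: eq_bigr => j _.
rewrite Fkron_mulE !mxE !mxtens_indexK /=; ring.
Qed.

Lemma Fkron_sandwich (d n : nat) (f : R -> 'cV[R]_d) (S : 'M[R]_n) tau :
  Fkron n f tau *m (S *m (Fkron n f tau)^T) = (f tau *m (f tau)^T) *t S.
Proof.
apply/matrixP => k l; rewrite Fkron_mulE -[S in LHS]trmxK -trmx_mul mxE Fkron_mulE.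
by rewrite !mxE big_ord1 !mxE mulrA.
Qed.

End Kronecker.

Section MatrixIntegral.
Context (R : realType).
Notation mu := (@lebesgue_measure R).
Variables (a b : R).

Definition mx_continuous (k l : nat) (g : R -> 'M[R]_(k, l)) : Prop :=
  forall i j, {within `[a, b], continuous (fun t => g t i j)}.

Lemma mx_continuousM (k l m : nat) (g : R -> 'M[R]_(k, l)) (h : R -> 'M[R]_(l, m)) :
  mx_continuous g -> mx_continuous h -> mx_continuous (fun t => g t *m h t).
Proof.
move=> cg ch i j; apply: eq_within_continuous (fun t => mxE _ _ _ _) _.
by apply: within_continuous_sum => u; exact: within_continuousM.
Qed.

Lemma mx_continuousD (k l : nat) (g h : R -> 'M[R]_(k, l)) :
  mx_continuous g -> mx_continuous h -> mx_continuous (fun t => g t + h t).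
Proof.
by move=> cg ch i j; apply: eq_within_continuous (fun t => mxE _ _ _ _) _;
  exact: within_continuousD.
Qed.

Lemma mx_continuous_cst (k l : nat) (A : 'M[R]_(k, l)) : mx_continuous (fun=> A).
Proof. by move=> i j; exact: within_continuous_cst. Qed.

Lemma mx_continuous_tr (k l : nat) (g : R -> 'M[R]_(k, l)) :
  mx_continuous g -> mx_continuous (fun t => (g t)^T).
Proof. by move=> cg i j; apply: eq_within_continuous (fun t => mxE _ _ _ _) _; exact: cg. Qed.

Lemma continuous_dot (k : nat) (g h : R -> 'cV[R]_k) :
  mx_continuous g -> mx_continuous h ->
  {within `[a, b], continuous (fun t => dot (g t) (h t))}.
Proof.
move=> cg ch; apply: eq_within_continuous (fun t => dotE _ _) _.
by apply: within_continuous_sum => i; exact: within_continuousM.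
Qed.

Lemma continuous_qform (k : nat) (A : R -> 'M[R]_k) (g : R -> 'cV[R]_k) :
  mx_continuous A -> mx_continuous g ->
  {within `[a, b], continuous (fun t => qform (A t) (g t))}.
Proof.
move=> cA cg; apply: eq_within_continuous (fun t => qformE _ _) _.
by apply: continuous_dot => //; exact: mx_continuousM.
Qed.

Lemma mxint_mull (k l m : nat) (A : 'M[R]_(k, l)) (g : R -> 'M[R]_(l, m)) :
  mx_continuous g -> mxint a b (fun t => A *m g t) = A *m mxint a b g.
Proof.
move=> cg; apply/matrixP => i j; rewrite !mxE.
under eq_Rintegral do rewrite mxE.
rewrite int_sum => [|u]; last first.
  by apply: within_continuousM; [exact: within_continuous_cst | exact: cg].
by apply: eq_bigr => u _; rewrite mxE intZ.
Qed.

Lemma mxint_mulr (k l m : nat) (A : 'M[R]_(l, m)) (g : R -> 'M[R]_(k, l)) :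
  mx_continuous g -> mxint a b (fun t => g t *m A) = mxint a b g *m A.
Proof.
move=> cg; apply/matrixP => i j; rewrite !mxE.
under eq_Rintegral do (rewrite mxE; under eq_bigr do rewrite mulrC).
rewrite int_sum => [|u]; last first.
  by apply: within_continuousM; [exact: within_continuous_cst | exact: cg].
by apply: eq_bigr => u _; rewrite mxE mulrC intZ.
Qed.

Lemma int_dot (k : nat) (c : 'cV[R]_k) (g : R -> 'cV[R]_k) : mx_continuous g ->
  \int[mu]_(t in `[a, b]) dot c (g t) = dot c (mxint a b g).
Proof. by move=> cg; rewrite /dot -mxint_mull // mxE. Qed.

End MatrixIntegral.

Section Bessel.
Context (R : realType) (d n : nat) (r : R) (f : R -> 'cV[R]_d).
Notation mu := (@lebesgue_measure R).
Hypothesis cf : mx_continuous (- r) 0 f.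
Hypothesis f_gram : posdef (gram r f).

Lemma Fkron_continuous : mx_continuous (- r) 0 (Fkron n f).
Proof.
move=> k j; apply: eq_within_continuous (fun t => FkronE _ _ _ _) _.
by apply: within_continuousM; [exact: cf | exact: within_continuous_cst].
Qed.

Definition window_int (phi : R -> 'cV[R]_n) : 'cV[R]_(d * n) :=
  mxint (- r) 0 (fun tau => Fkron n f tau *m phi tau).

Lemma window_intE phi k : window_int phi k 0 =
  \int[mu]_(tau in `[- r, 0])
    (f tau (mxtens_unindex k).1 0 * phi tau (mxtens_unindex k).2 0).
Proof. by rewrite mxE; under eq_Rintegral do rewrite Fkron_mulE. Qed.

Lemma mxint_gram_tens (S : 'M[R]_n) :
  mxint (- r) 0 (fun tau => (f tau *m (f tau)^T) *t S) = gram r f *t S.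
Proof.
apply/matrixP => k l; rewrite !mxE.
under eq_Rintegral do rewrite mxE mulrC.
rewrite intZ 1?mulrC //.
by apply: mx_continuousM => //; exact: mx_continuous_tr.
Qed.

(** Bessel's inequality for the functions [f], in the inner product of [S]: the
    projection of [phi] on their span is [(F tau)^T *m zeta] with
    [zeta = (Fgram (x) I) *m window_int phi], and the residual has a nonnegative
    integral. *)
Lemma window_int_bessel (S : 'M[R]_n) (phi : R -> 'cV[R]_n) :
  posdef S -> mx_continuous (- r) 0 phi ->
  qform (Fgram r f *t S) (window_int phi) <=
  \int[mu]_(tau in `[- r, 0]) qform S (phi tau).
Proof.
move=> pS cphi; have [sS _] := pS.
have ug := posdef_unit f_gram.
have sg : (Fgram r f)^T = Fgram r f by rewrite /Fgram trmx_inv (proj1 f_gram).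
set eta := window_int phi.
pose zeta := (Fgram r f *t 1%:M) *m eta.
pose kappa tau := (Fkron n f tau)^T *m zeta.
have cF := Fkron_continuous.
have cFphi : mx_continuous (- r) 0 (fun tau => Fkron n f tau *m phi tau).
  exact: mx_continuousM.
have pointwise tau : qform S (phi tau - kappa tau) =
    qform S (phi tau) +
    (- 2 * dot ((1%:M *t S)^T *m zeta) (Fkron n f tau *m phi tau)
     + dot zeta (((f tau *m (f tau)^T) *t S) *m zeta)).
  have -> : dot ((1%:M *t S)^T *m zeta) (Fkron n f tau *m phi tau) =
      dot (kappa tau) (S *m phi tau).
    rewrite dot_mulmx trmxK tens_Fkron /kappa dot_mulmx trmxK.
    by have -> : (fun t => 1%:M *m f t) = f by apply/funext => t; rewrite mul1mx.
  have -> : dot zeta (((f tau *m (f tau)^T) *t S) *m zeta) =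
      dot (kappa tau) (S *m kappa tau).
    by rewrite -Fkron_sandwich -!mulmxA /kappa dot_mulmx trmxK.
  rewrite !qformE mulmxBr !dotDr !dotDl !dotNr !dotNl opprK.
  rewrite [dot (phi tau) (S *m kappa tau)]dotC dot_mulmx sS; ring.
have := @Rintegral_ge0 _ _ _ mu `[- r, 0] (fun tau => qform S (phi tau - kappa tau))
  (fun tau _ => posdef_ge0 _ pS).
under eq_Rintegral do rewrite pointwise.
have cG : mx_continuous (- r) 0 (fun tau => (f tau *m (f tau)^T) *t S).
  rewrite (_ : (fun tau => _) = fun tau =>
    Fkron n f tau *m (S *m (Fkron n f tau)^T)); last first.
    by apply/funext => tau; rewrite Fkron_sandwich.
  apply: mx_continuousM => //; apply: mx_continuousM; first exact: mx_continuous_cst.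
  exact: mx_continuous_tr.
have cB : mx_continuous (- r) 0 (fun tau => ((f tau *m (f tau)^T) *t S) *m zeta).
  by apply: mx_continuousM => //; exact: mx_continuous_cst.
have c1 : {within `[- r, 0], continuous (fun tau => qform S (phi tau))}.
  by apply: continuous_qform => //; exact: mx_continuous_cst.
have c2 : {within `[- r, 0], continuous (fun tau =>
    dot ((1%:M *t S)^T *m zeta) (Fkron n f tau *m phi tau))}.
  by apply: continuous_dot => //; exact: mx_continuous_cst.
have c3 : {within `[- r, 0], continuous (fun tau =>
    dot zeta (((f tau *m (f tau)^T) *t S) *m zeta))}.
  by apply: continuous_dot => //; exact: mx_continuous_cst.
rewrite intD //; last first.
  apply: within_continuousD => //.
  by apply: within_continuousM => //; exact: within_continuous_cst.
rewrite intD //; last by apply: within_continuousM => //; exact: within_continuous_cst.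
rewrite intZ // !int_dot // mxint_mulr // mxint_gram_tens -/(window_int phi) -/eta.
rewrite dot_mulmx trmxK.
have -> : (gram r f *t S) *m zeta = (1%:M *t S) *m eta.
  by rewrite /zeta mulmxA tensmx_mul mulmxV // mulmx1.
have -> : dot zeta ((1%:M *t S) *m eta) = qform (Fgram r f *t S) eta.
  by rewrite /zeta dot_mulmx trmx_tens sg trmx1 mulmxA tensmx_mul mulmx1 mul1mx qformE.
lra.
Qed.

End Bessel.

(** * Quadratic functionals of the history *)

Section QuadraticFunctionals.
Context (R : realType) (n : nat) (r : R).
Hypothesis r_gt0 : 0 < r.
Notation mu := (@lebesgue_measure R).
Notation hist := (R -> 'cV[R]_n).
Notation H := (@hist_cont R n r).
Notation norm := (sup_norm r).

Lemma coord_le_norm (k l : nat) (u : 'M[R]_(k, l)) i j : `|u i j| <= `|u|.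
Proof.
rewrite [`|u|]mx_normrE; exact: (le_bigmax _ (fun ij => `|u ij.1 ij.2|) (i, j)).
Qed.


Lemma norm_sqr_le_dot (k : nat) (u : 'cV[R]_k) : `|u| ^+ 2 <= dot u u.
Proof.
have [n0|n0] := eqVneq `|u| 0; first by rewrite n0 expr0n dot_ge0.
have [[i j] /= uE] := mx_norm_neq0 n0.
rewrite [`|u|]uE ord1 real_normK ?num_real //; exact: sqr_coord_le_dot.
Qed.

Lemma int_qform_sum (a b : R) (k : nat) (A : R -> 'M[R]_k) (u : R -> 'cV[R]_k) :
  mx_continuous a b A -> mx_continuous a b u ->
  \int[mu]_(t in `[a, b]) qform (A t) (u t) =
  \sum_i \sum_j \int[mu]_(t in `[a, b]) (A t i j * (u t i 0 * u t j 0)).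
Proof.
move=> cA cu; have c i j :
    {within `[a, b], continuous (fun t => A t i j * (u t i 0 * u t j 0))}.
  by do !apply: within_continuousM.
under eq_Rintegral do rewrite qform_sum.
rewrite int_sum; last by move=> i; exact: within_continuous_sum.
by apply: eq_bigr => i _; rewrite int_sum.
Qed.

Lemma hist_contD phi psi : H phi -> H psi -> H (fun t => phi t + psi t).
Proof. by move=> c1 c2 t; apply: cvgD; [exact: c1 | exact: c2]. Qed.

Lemma within_continuous_coord (D : set R) (k l : nat) (g : R -> 'M[R]_(k, l)) i j :
  {within D, continuous g} -> {within D, continuous (fun t => g t i j)}.
Proof.
move=> cg t; exact: (continuous_cvg _ (@coord_continuous R k l i j (g t)) (cg t)).
Qed.

Lemma hist_cont_coord phi : H phi -> mx_continuous (- r) 0 phi.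
Proof. by move=> cphi i j; exact: within_continuous_coord. Qed.

Lemma le_sup_norm phi t : H phi -> - r <= t <= 0 -> `|phi t| <= norm phi.
Proof.
move=> cphi trange.
have cn : {within `[- r, 0], continuous (fun t => `|phi t|)}.
  by move=> s; apply: cvg_norm; exact: cphi.
have r0 : - r <= 0 by rewrite oppr_le0 ltW.
have [c _ cP] := within_continuous_bounded r0 cn.
apply: ub_le_sup; last by exists t => //=; rewrite in_itv.
exists c => _ /= [s + <-]; rewrite in_itv /= => srange.
by have := cP s srange; rewrite normr_id.
Qed.

Lemma sup_norm_ge0 phi : H phi -> 0 <= norm phi.
Proof.
move=> cphi; apply: le_trans (le_sup_norm (t := 0) cphi _) => //.
by rewrite lexx oppr_le0 ltW.
Qed.

Lemma coord_le_sup_norm phi i t : H phi -> - r <= t <= 0 -> `|phi t i 0| <= norm phi.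
Proof. by move=> cphi /(le_sup_norm cphi); apply: le_trans (coord_le_norm _ _ _). Qed.

Definition hist_linear (L : hist -> R) : Prop :=
  forall a h1 h2, H h1 -> H h2 ->
    L (fun t => a *: h1 t + h2 t) = a * L h1 + L h2.

Definition hist_bounded (L : hist -> R) : Prop :=
  exists2 c, 0 <= c & forall h, H h -> `|L h| <= c * norm h.

(** The quadratic functionals of bounded bilinear forms on C([-r, 0]; R^n); the forms
    are not assumed symmetric, so that a product of two linear functionals
    qualifies. *)
Definition hist_quadratic (v : hist -> R) : Prop :=
  exists B : hist -> hist -> R,
  [/\ forall psi, H psi -> hist_linear (B psi) /\ hist_linear (B ^~ psi),
      exists2 c, 0 <= c & forall phi psi, H phi -> H psi ->
        `|B phi psi| <= c * norm phi * norm psi &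
      forall phi, H phi -> v phi = B phi phi].

Lemma hist_linearD L h1 h2 : hist_linear L -> H h1 -> H h2 ->
  L (fun t => h1 t + h2 t) = L h1 + L h2.
Proof.
move=> linL c1 c2; rewrite -[L h1]mul1r -linL //; congr L.
by apply/funext => t; rewrite scale1r.
Qed.

Lemma hist_quadratic_differentiable v :
  hist_quadratic v -> hist_differentiable r v.
Proof.
move=> [B [linB [c c0 bB] vB]] phi cphi.
exists (fun h => B phi h + B h phi); split.
- move=> a h1 h2 c1 c2; have [-> //] := linB phi cphi.
  by have [_ /= ->] := linB phi cphi; rewrite // mulrDr addrACA.
- exists (2 * c * norm phi) => h ch; apply: (le_trans (ler_normD _ _)).
  have := bB _ _ cphi ch; have := bB _ _ ch cphi; lra.
move=> e e0; exists (e / (c + 1)); first by rewrite divr_gt0 // ltr_wpDl.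
move=> h ch; rewrite ltr_pdivlMr ?ltr_wpDl // => hlt.
have cs := hist_contD cphi ch.
have -> : v (fun t => phi t + h t) - v phi - (B phi h + B h phi) = B h h.
  rewrite !vB // hist_linearD //; last by have [] := linB _ cs.
  rewrite (hist_linearD (proj2 (linB phi cphi))) //.
  rewrite (hist_linearD (proj2 (linB h ch))) //; ring.
apply: le_trans (bB _ _ ch ch) _; apply: ler_wpM2r; first exact: sup_norm_ge0.
by have := sup_norm_ge0 ch; nra.
Qed.

Lemma hist_quadratic_bounded v : hist_quadratic v ->
  exists2 c, 0 <= c & forall phi, H phi -> v phi <= c * norm phi ^+ 2.
Proof.
move=> [B [_ [c c0 bB] vB]]; exists c => // phi cphi; rewrite vB // expr2 mulrA.
by apply: le_trans (bB _ _ cphi cphi); exact: ler_norm.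
Qed.

Lemma eq_hist_quadratic v1 v2 : (forall phi, H phi -> v1 phi = v2 phi) ->
  hist_quadratic v2 -> hist_quadratic v1.
Proof.
by move=> e [B [linB bB vB]]; exists B; split => // phi cphi; rewrite e // vB.
Qed.

Lemma hist_quadraticD v1 v2 : hist_quadratic v1 -> hist_quadratic v2 ->
  hist_quadratic (fun phi => v1 phi + v2 phi).
Proof.
move=> [B1 [lin1 [c1 c10 b1] vB1]] [B2 [lin2 [c2 c20 b2] vB2]].
exists (fun phi psi => B1 phi psi + B2 phi psi); split.
- move=> psi cpsi; have [l1 l1'] := lin1 psi cpsi; have [l2 l2'] := lin2 psi cpsi.
  split=> a h1 h2 ch1 ch2 /=; first by rewrite l1 // l2 // mulrDr addrACA.
  by rewrite (l1' a) // (l2' a) // mulrDr addrACA.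
- exists (c1 + c2); first exact: addr_ge0.
  move=> phi psi cphi cpsi; apply: le_trans (ler_normD _ _) _.
  have := b1 _ _ cphi cpsi; have := b2 _ _ cphi cpsi; lra.
- by move=> phi cphi; rewrite vB1 // vB2.
Qed.

Lemma hist_quadratic0 : hist_quadratic (fun=> 0).
Proof.
exists (fun _ _ => 0); split => //.
- by move=> psi _; split => a h1 h2 _ _; rewrite mulr0 addr0.
- by exists 0 => // phi psi _ _; rewrite normr0 !mul0r.
Qed.

Lemma hist_quadratic_sum (I : finType) (v : I -> hist -> R) :
  (forall i, hist_quadratic (v i)) -> hist_quadratic (fun phi => \sum_i v i phi).
Proof.
move=> qv; rewrite (_ : (fun _ => _) = \sum_i v i); last first.
  by apply/funext => phi; rewrite fct_sumE.
elim/big_ind : _ => // [|v1 v2]; [exact: hist_quadratic0 | exact: hist_quadraticD].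
Qed.

Lemma hist_quadraticM L1 L2 : hist_linear L1 -> hist_bounded L1 ->
  hist_linear L2 -> hist_bounded L2 -> hist_quadratic (fun phi => L1 phi * L2 phi).
Proof.
move=> lin1 [c1 c10 b1] lin2 [c2 c20 b2].
exists (fun phi psi => L1 phi * L2 psi); split => //.
- move=> psi _; split => a h1 h2 ch1 ch2; first by rewrite lin2 //; ring.
  by rewrite lin1 //; ring.
- exists (c1 * c2); first exact: mulr_ge0.
  move=> phi psi cphi cpsi; rewrite normrM.
  have -> : c1 * c2 * norm phi * norm psi = (c1 * norm phi) * (c2 * norm psi) by ring.
  by apply: ler_pM => //; [exact: b1 | exact: b2].
Qed.

Lemma hist_quadraticZ c v : hist_quadratic v -> hist_quadratic (fun phi => c * v phi).
Proof.
move=> [B [lin [b b0 bB] vB]]; exists (fun phi psi => c * B phi psi); split.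
- move=> psi /lin[l l']; split => a h1 h2 ch1 ch2; first by rewrite l //; ring.
  by rewrite (l' a) //; ring.
- exists (`|c| * b); first exact: mulr_ge0.
  move=> phi psi cphi cpsi; rewrite normrM -!mulrA; apply: ler_wpM2l => //.
  by rewrite mulrA; exact: bB.
- by move=> phi cphi; rewrite vB.
Qed.

Let r0 : - r <= 0. Proof. by rewrite oppr_le0 ltW. Qed.

Lemma hist_eval0_linear i : hist_linear (fun phi => phi 0 i 0).
Proof. by move=> a h1 h2 _ _; rewrite !mxE. Qed.

Lemma hist_eval0_bounded i : hist_bounded (fun phi => phi 0 i 0).
Proof.
exists 1 => // h ch; rewrite mul1r; apply: coord_le_sup_norm => //.
by rewrite lexx r0.
Qed.

Section Weighted.
Variable a : R -> R.
Hypothesis ca : {within `[- r, 0], continuous a}.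

Lemma hist_int_linear i :
  hist_linear (fun phi => \int[mu]_(t in `[- r, 0]) (a t * phi t i 0)).
Proof.
move=> c h1 h2 /hist_cont_coord ch1 /hist_cont_coord ch2.
have ci h : mx_continuous (- r) 0 h -> {within `[- r, 0], continuous (fun t => a t * h t i 0)}.
  by move=> ch; exact: within_continuousM.
rewrite -intZ; last exact: ci.
rewrite -intD; last exact: ci.
  by apply: eq_Rintegral => t _; rewrite !mxE; ring.
by apply: within_continuousM; [exact: within_continuous_cst | exact: ci].
Qed.

Lemma hist_int_bounded i :
  hist_bounded (fun phi => \int[mu]_(t in `[- r, 0]) (a t * phi t i 0)).
Proof.
have [c c0 cP] := within_continuous_bounded r0 ca.
exists (c * r); first by rewrite mulr_ge0 // ltW.
move=> h ch; have -> : c * r * norm h = c * norm h * (0 - - r) by ring.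
apply: int_norm_le => //.
  by apply: within_continuousM => //; exact: hist_cont_coord.
move=> t tr; rewrite normrM; apply: ler_pM => //; first exact: cP.
exact: coord_le_sup_norm.
Qed.

Lemma hist_quadratic_int i j : hist_quadratic
  (fun phi => \int[mu]_(t in `[- r, 0]) (a t * (phi t i 0 * phi t j 0))).
Proof.
exists (fun phi psi => \int[mu]_(t in `[- r, 0]) (a t * (phi t i 0 * psi t j 0))).
have [c c0 cP] := within_continuous_bounded r0 ca.
have cI phi psi : H phi -> H psi ->
    {within `[- r, 0], continuous (fun t => a t * (phi t i 0 * psi t j 0))}.
  by move=> /hist_cont_coord cphi /hist_cont_coord cpsi; do !apply: within_continuousM => //.
split => //.
- move=> psi cpsi; split => b h1 h2 ch1 ch2.
    rewrite -intZ; last exact: cI.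
    rewrite -intD; last exact: cI.
      by apply: eq_Rintegral => t _; rewrite !mxE; ring.
    by apply: within_continuousM; [exact: within_continuous_cst | exact: cI].
  rewrite -intZ; last exact: cI.
  rewrite -intD; last exact: cI.
    by apply: eq_Rintegral => t _; rewrite !mxE; ring.
  by apply: within_continuousM; [exact: within_continuous_cst | exact: cI].
- exists (c * r); first by rewrite mulr_ge0 // ltW.
  move=> phi psi cphi cpsi.
  have -> : c * r * norm phi * norm psi = c * (norm phi * norm psi) * (0 - - r) by ring.
  apply: int_norm_le => //; first exact: cI.
  move=> t tr; rewrite !normrM; apply: ler_pM => //; first exact: cP.
  by apply: ler_pM => //; exact: coord_le_sup_norm.
Qed.

End Weighted.

End QuadraticFunctionals.

(** * Derivatives along solutions *)

Section Halfline.
Context (R : realType).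
Notation mu := (@lebesgue_measure R).

(** Clamping the argument replaces a solution, which lives on a half-line, by a continuous
    function on the whole line, to which the theorems on two-sided derivatives apply. *)
Lemma halfline_extension (c : R) (y : R -> R) :
  {within `[c, +oo[, continuous y} -> continuous (fun s => y (Num.max c s)).
Proof.
move=> /subspace_continuousP cy s.
have cm : Num.max c u @[u --> s] --> Num.max c s.
  by apply: (@continuous_max _ R (fun=> c) id s); [exact: cvg_cst | exact: cvg_id].
have Ic u : `[c, +oo[%classic (Num.max c u) by rewrite /= in_itv /= andbT le_max lexx.
move=> A /(cy _ (Ic s)) W.
have W' : nbhs s [set u | `[c, +oo[%classic (Num.max c u) -> A (y (Num.max c u))].
  exact: (cm _ (W : nbhs (Num.max c s) [set v | `[c, +oo[%classic v -> A (y v)])).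
apply: (@filterS _ (nbhs s) _ _ _ _ W') => u; apply; exact: Ic.
Qed.

Lemma deriv_on_mulmx (k l : nat) (D : set R) (A : 'M[R]_(k, l)) (u : R -> 'cV[R]_l) t du :
  deriv_on D u t du -> deriv_on D (fun s => A *m u s) t (A *m du).
Proof.
move=> dU; apply: deriv_on_mx => i j; rewrite mxE.
apply: eq_deriv_on_all (fun s => esym (mxE _ _ _ _)) _.
by apply: deriv_on_sum => e; apply: deriv_onZ; exact: deriv_on_coord.
Qed.

Lemma deriv_on_dot (k : nat) (D : set R) (u v : R -> 'cV[R]_k) t du dv :
  deriv_on D u t du -> deriv_on D v t dv ->
  deriv_on D (fun s => dot (u s) (v s) : R^o) t (dot du (v t) + dot (u t) dv).
Proof.
move=> dU dV; rewrite !dotE -big_split /=.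
apply: eq_deriv_on_all (fun s => esym (dotE _ _)) _.
by apply: deriv_on_sum => e; apply: deriv_onM; exact: deriv_on_coord.
Qed.

Lemma deriv_on_qform (k : nat) (D : set R) (A : 'M[R]_k) (u : R -> 'cV[R]_k) t du :
  A^T = A -> deriv_on D u t du ->
  deriv_on D (fun s => qform A (u s) : R^o) t (2 * dot (A *m u t) du).
Proof.
move=> sA dU; apply: eq_deriv_on_all (fun s => esym (qformE _ _)) _.
have -> : 2 * dot (A *m u t) du = dot du (A *m u t) + dot (u t) (A *m du).
  by rewrite [dot du _]dotC [dot (A *m u t) du]dot_mulmx sA; ring.
by apply: deriv_on_dot => //; exact: deriv_on_mulmx.
Qed.

Lemma deriv_on_col (k l : nat) (D : set R) (u : R -> 'cV[R]_k) (v : R -> 'cV[R]_l) t du dv :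
  deriv_on D u t du -> deriv_on D v t dv ->
  deriv_on D (fun s => col_mx (u s) (v s)) t (col_mx du dv).
Proof.
move=> dU dV; apply: deriv_on_mx => i j.
rewrite -[i]splitK; case: (fintype.split i) => e /=.
  rewrite col_mxEu; apply: eq_deriv_on_all (fun s => esym (col_mxEu _ _ _ _)) _.
  exact: deriv_on_coord.
rewrite col_mxEd; apply: eq_deriv_on_all (fun s => esym (col_mxEd _ _ _ _)) _.
exact: deriv_on_coord.
Qed.

Lemma deriv_on_window (r t0 t : R) (a a' y : R -> R) :
  0 < r -> {within `[- r, 0], continuous a'} ->
  (forall s, s \in `[- r, 0] -> deriv_on `[- r, 0] (a : R -> R^o) s (a' s)) ->
  {within `[t0 - r, +oo[, continuous y} -> t0 <= t ->
  deriv_on `[t0, +oo[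
    (fun s => \int[mu]_(e in `[- r, 0]) (a e * y (s + e)) : R^o) t
    (a 0 * y t - a (- r) * y (t - r) - \int[mu]_(e in `[- r, 0]) (a' e * y (t + e))).
Proof.
move=> r0 ca' da cy t0t; pose z s := y (Num.max (t0 - r) s).
have zE s e : t0 <= s -> - r <= e <= 0 -> z (s + e) = y (s + e).
  by move=> t0s /andP[re _]; rewrite /z max_r //; lra.
have intE b s : t0 <= s -> \int[mu]_(e in `[- r, 0]) (b e * z (s + e)) =
    \int[mu]_(e in `[- r, 0]) (b e * y (s + e)).
  move=> t0s; apply: eq_Rintegral => e; rewrite inE /= in_itv /= => er.
  by rewrite zE.
have rr : - r <= - r <= 0 by rewrite lexx oppr_le0 ltW.
have r00 : - r <= 0 <= 0 by rewrite oppr_le0 ltW /=.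
rewrite -intE // -(zE _ _ t0t rr).
have -> : y t = z t by rewrite -[t]addr0 zE.
apply: (@eq_deriv_on _ _ _ (fun s => \int[mu]_(e in `[- r, 0]) (a e * z (s + e)))).
- by rewrite /= in_itv /= t0t.
- by move=> s; rewrite /= in_itv /= andbT => t0s; exact: intE.
apply: is_derive_deriv_on; apply: is_derive_window => //.
exact: halfline_extension.
Qed.

End Halfline.

(** * The Krasovskii functional *)

Section Lyapunov.
Context (R : realType) (d n : nat) (r : R) (f : R -> 'cV[R]_d) (M : 'M[R]_d).
Notation mu := (@lebesgue_measure R).
Hypothesis r_gt0 : 0 < r.
Hypothesis f_ode : forall tau, tau \in `[- r, 0] ->
  deriv_on `[- r, 0] f tau (M *m f tau).
Hypothesis f_gram : posdef (gram r f).
Variables (P : 'M[R]_n) (Q : 'M[R]_(n, d * n)) (R0 : 'M[R]_(d * n)) (S U : 'M[R]_n).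
Hypotheses (P_sym : P^T = P) (R0_sym : R0^T = R0).
Hypotheses (S_pos : posdef S) (U_pos : posdef U).
Hypothesis lmi : posdef (lyap_lmi r f P Q R0 S).

Let r0 : - r < 0. Proof. by rewrite oppr_lt0. Qed.

Let fi_ode i tau : tau \in `[- r, 0] ->
  deriv_on `[- r, 0] (fun t => f t i 0 : R^o) tau ((M *m f tau) i 0).
Proof. by move=> /f_ode; exact: deriv_on_coord. Qed.

Lemma ode_continuous : mx_continuous (- r) 0 f.
Proof.
move=> i j; rewrite ord1.
by have [] := @deriv_on_segment R _ _ (fun t => f t i 0) (fun t => (M *m f t) i 0) r0 (@fi_ode i).
Qed.

Let cf := ode_continuous.

Let cMf : mx_continuous (- r) 0 (fun t => M *m f t).
Proof. by apply: mx_continuousM => //; exact: mx_continuous_cst. Qed.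

(** The Krasovskii functional. The weight [S + (tau + r) *: U] is chosen for its
    derivative along a moving window: [S + r *: U] at the present, [- S] at the delay, and
    [- U] under the integral. *)
Definition lyapunov (phi : R -> 'cV[R]_n) : R :=
  qform (block_mx P Q Q^T R0) (col_mx (phi 0) (window_int r f phi))
  + \int[mu]_(tau in `[- r, 0]) qform (S + (tau + r) *: U) (phi tau).

Let cSU : mx_continuous (- r) 0 (fun tau => S + (tau + r) *: U).
Proof.
apply: mx_continuousD; first exact: mx_continuous_cst.
move=> i j; apply: eq_within_continuous (fun t => mxE _ _ _ _) _.
apply: within_continuousM; last exact: within_continuous_cst.
by apply/continuous_within => t; apply: cvgD; [exact: cvg_id | exact: cvg_cst].
Qed.

Lemma eq_lyapunov phi psi :
  (forall theta, theta \in `[- r, 0] -> phi theta = psi theta) ->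
  lyapunov phi = lyapunov psi.
Proof.
move=> e; rewrite /lyapunov; congr (qform _ (col_mx _ _) + _).
- by apply: e; rewrite in_itv /= lexx oppr_le0 ltW.
- apply/colP => k; rewrite !window_intE; apply: eq_Rintegral => t.
  by rewrite inE => /e ->.
- by apply: eq_Rintegral => t; rewrite inE => /e ->.
Qed.

(** Bessel's inequality bounds the integral part from below, which completes [R0] to the
    lower right block of the matrix in [lmi]: the matrix [block_mx P Q Q^T R0] need not be
    positive by itself. *)
Lemma lyapunov_ge phi : hist_cont r phi ->
  qform (lyap_lmi r f P Q R0 S) (col_mx (phi 0) (window_int r f phi)) <= lyapunov phi.
Proof.
move=> /hist_cont_coord cphi.
have bessel := window_int_bessel cf f_gram S_pos cphi.
rewrite /lyapunov /lyap_lmi !qform_block qformD addrA lerD2l.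
apply: le_trans bessel _; apply: le_Rintegral => //.
- by apply: continuous_integrable; apply: continuous_qform => //; exact: mx_continuous_cst.
- by apply: continuous_integrable; exact: continuous_qform.
move=> t /=; rewrite in_itv /= => /andP[rt _].
rewrite qformD lerDl qformZ mulr_ge0 ?posdef_ge0 //; lra.
Qed.

Lemma lyapunov_coercive :
  exists2 c : R, 0 < c & forall phi, hist_cont r phi -> c * `|phi 0| ^+ 2 <= lyapunov phi.
Proof.
have [c c0 cP] := posdef_coercive lmi; exists c => // phi /lyapunov_ge.
apply: le_trans; apply: le_trans (cP _); rewrite ler_pM2l // dot_col.
apply: le_trans (norm_sqr_le_dot _) _; rewrite lerDl; exact: dot_ge0.
Qed.

Lemma lyapunov_ge0 phi : hist_cont r phi -> 0 <= lyapunov phi.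
Proof.
have [c c0 cP] := lyapunov_coercive => /cP; apply: le_trans.
by rewrite mulr_ge0 ?sqr_ge0 // ltW.
Qed.

Lemma lyapunov_quadratic : hist_quadratic r lyapunov.
Proof.
apply: hist_quadraticD.
  apply: eq_hist_quadratic (fun phi _ => qform_sum _ _) _.
  apply: hist_quadratic_sum => i; apply: hist_quadratic_sum => j.
  apply: hist_quadraticZ.
  have lin k : hist_linear r (fun phi : R -> 'cV[R]_n =>
        col_mx (phi 0) (window_int r f phi) k 0) /\
      hist_bounded r (fun phi : R -> 'cV[R]_n => col_mx (phi 0) (window_int r f phi) k 0).
    rewrite -[k]splitK; case: (fintype.split k) => e /=.
      under eq_fun do rewrite col_mxEu.
      by split; [exact: hist_eval0_linear | exact: hist_eval0_bounded].
    under eq_fun do rewrite col_mxEd window_intE.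
    by split; [exact: hist_int_linear | exact: hist_int_bounded].
  by have [li bi] := lin i; have [lj bj] := lin j; exact: hist_quadraticM.
pose a i j t := (S + (t + r) *: U) i j.
apply: (@eq_hist_quadratic _ _ _ _ (fun phi => \sum_i \sum_j
    \int[mu]_(t in `[- r, 0]) (a i j t * (phi t i 0 * phi t j 0)))); last first.
  apply: hist_quadratic_sum => i; apply: hist_quadratic_sum => j.
  by apply: hist_quadratic_int => //; exact: cSU.
move=> phi /hist_cont_coord cphi.
exact: int_qform_sum.
Qed.

Variables (t0 : R) (x : R -> 'cV[R]_n).
Hypothesis cx : {within `[t0 - r, +oo[, continuous x}.

Let cxi i : {within `[t0 - r, +oo[, continuous (fun s => x s i 0)}.
Proof. exact: within_continuous_coord. Qed.

Lemma segment_hist_cont t : t0 <= t -> hist_cont r (segment x t).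
Proof.
move=> t0t; apply/subspace_continuousP => s /=; rewrite in_itv /= => /andP[rs s0].
have ts : `[t0 - r, +oo[%classic (t + s) by rewrite /= in_itv /= andbT; lra.
have /subspace_continuousP /(_ _ ts) cts := cx.
move=> A /cts W.
have ct : t + e @[e --> s] --> t + s by apply: cvgD; [exact: cvg_cst | exact: cvg_id].
have W' : nbhs s [set e | `[t0 - r, +oo[%classic (t + e) -> A (x (t + e))].
  exact: (ct _ (W : nbhs (t + s) [set v | `[t0 - r, +oo[%classic v -> A (x v)])).
apply: (@filterS _ (nbhs s) _ _ _ _ W') => e /= h; rewrite in_itv /= => /andP[re e0].
by apply: h; rewrite in_itv /= andbT; lra.
Qed.

(** The integral state satisfies the differential equation that makes the matrix
    [bfF] appear. *)
Lemma deriv_on_window_int t : t0 <= t ->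
  deriv_on `[t0, +oo[ (fun s => window_int r f (segment x s)) t
    (Fkron n f 0 *m x t - Fkron n f (- r) *m x (t - r)
     - (M *t 1%:M) *m window_int r f (segment x t)).
Proof.
move=> t0t; apply: deriv_on_mx => k j; rewrite ord1.
apply: eq_deriv_on_all (fun s => esym (window_intE _ _ _ _)) _.
pose i := (mxtens_unindex k).1; pose j' := (mxtens_unindex k).2.
have := @deriv_on_window R r t0 t (fun s => f s i 0) (fun s => (M *m f s) i 0)
  (fun s => x s j' 0) r_gt0 (@cMf i 0) (@fi_ode i) (@cxi j') t0t.
set lhs := (X in deriv_on _ _ _ X -> _); set rhs := (X in _ -> deriv_on _ _ _ X).
suff -> : lhs = rhs by []; rewrite /lhs /rhs.
have cphi := hist_cont_coord (segment_hist_cont t0t).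
rewrite /window_int -mxint_mull; last by apply: mx_continuousM => //; exact: Fkron_continuous.
have subE (A B C : 'cV[R]_(d * n)) : (A - B - C) k 0 = A k 0 - B k 0 - C k 0.
  by rewrite !mxE.
rewrite subE !Fkron_mulE; congr (_ - _ - _); rewrite mxE.
by apply: eq_Rintegral => e _; rewrite tens_Fkron mul1mx Fkron_mulE.
Qed.

Lemma deriv_on_lyapunov (t : R) (dx : 'cV[R]_n) : t0 <= t ->
  deriv_on `[t0, +oo[ x t dx ->
  let eta := window_int r f (segment x t) in
  deriv_on `[t0, +oo[ (fun s => lyapunov (segment x s) : R^o) t
    (2 * dot (P *m x t + Q *m eta) dx
     + 2 * dot (Q^T *m x t + R0 *m eta)
         (Fkron n f 0 *m x t - Fkron n f (- r) *m x (t - r) - (M *t 1%:M) *m eta)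
     + (qform (S + r *: U) (x t) - qform S (x (t - r))
        - \int[mu]_(tau in `[- r, 0]) qform U (x (t + tau)))).
Proof.
move=> t0t dxP eta; apply: deriv_onD.
  have sym : (block_mx P Q Q^T R0)^T = block_mx P Q Q^T R0.
    by rewrite tr_block_mx trmxK P_sym R0_sym.
  have := deriv_on_qform sym (deriv_on_col dxP (deriv_on_window_int t0t)).
  rewrite -/eta mul_block_col dot_col mulrDr.
  by apply: eq_deriv_on_all => s; rewrite /segment addr0.
pose y i j s := x s i 0 * x s j 0.
have cy i j : {within `[t0 - r, +oo[, continuous (y i j)} by exact: within_continuousM.
pose a i j tau := S i j + (tau + r) * U i j.
have da i j tau : tau \in `[- r, 0] -> deriv_on `[- r, 0] (a i j : R -> R^o) tau (U i j).
  move=> _; have did : deriv_on `[- r, 0] (fun s : R => s : R^o) tau 1.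
    by apply: is_derive_deriv_on; exact: is_derive_id.
  have := deriv_onD (deriv_on_cst _ (S i j) tau)
    (deriv_onM (deriv_onD did (deriv_on_cst _ r tau)) (deriv_on_cst _ (U i j) tau)).
  by rewrite mulr0 !addr0 mul1r add0r.
have cU i j : {within `[- r, 0], continuous (fun=> U i j)} by exact: within_continuous_cst.
have dy i j := @deriv_on_window R r t0 t (a i j) (fun=> U i j) (y i j) r_gt0
  (cU i j) (@da i j) (cy i j) t0t.
have cphi s : t0 <= s -> mx_continuous (- r) 0 (fun e => x (s + e)).
  by move=> t0s; exact: hist_cont_coord (segment_hist_cont t0s).
have := deriv_on_sum (fun i => deriv_on_sum (dy i)).
rewrite [X in deriv_on _ _ _ X -> _](_ : _ = qform (S + r *: U) (x t) - qform S (x (t - r))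
        - \int[mu]_(tau in `[- r, 0]) qform U (x (t + tau))); last first.
  rewrite int_qform_sum; [|exact: mx_continuous_cst|exact: cphi].
  rewrite !qform_sum -!sumrB; apply: eq_bigr => i _; rewrite -!sumrB.
  by apply: eq_bigr => j _; rewrite /a /y !mxE add0r addNr mul0r addr0.
apply: eq_deriv_on; first by rewrite /= in_itv /= t0t.
move=> s; rewrite /= in_itv /= andbT => t0s.
rewrite int_qform_sum; [|exact: cSU|exact: cphi].
by apply: eq_bigr => i _; apply: eq_bigr => j _; apply: eq_Rintegral => e _; rewrite !mxE.
Qed.

End Lyapunov.

(** * Solutions with zero input *)

Lemma bfF_col (R : realType) (d n q : nat) (r : R) (f : R -> 'cV[R]_d) (M : 'M[R]_d)
    (x0 x1 : 'cV[R]_n) (eta : 'cV[R]_(d * n)) (w : 'cV[R]_q) :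
  bfF n q r f M *m col_mx (col_mx x0 (col_mx x1 eta)) w =
  Fkron n f 0 *m x0 - Fkron n f (- r) *m x1 - (M *t 1%:M) *m eta.
Proof. by rewrite /bfF !mul_row_col mul0mx addr0 !mulNmx addrA. Qed.

Section HalflineContinuity.
Context (R : realType).

Lemma within_continuous_shift (c r : R) (y : R -> R) :
  {within `[c - r, +oo[, continuous y} -> {within `[c, +oo[, continuous (fun s => y (s - r))}.
Proof.
move=> cy; pose z s := y (Num.max (c - r) (s - r)).
have cz : {within `[c, +oo[, continuous z}.
  apply: continuous_within => s.
  apply: (@continuous_comp _ _ _ (fun s : R => s - r) (fun s => y (Num.max (c - r) s))).
    by apply: cvgB; [exact: cvg_id | exact: cvg_cst].
  exact: halfline_extension.
apply: subspace_eq_continuous cz => s; rewrite inE /= in_itv /= andbT => cs.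
by rewrite /z /from_subspace /= max_r // lerD2r.
Qed.

Lemma within_continuous_subset (D D' : set R) (y : R -> R) : D' `<=` D ->
  {within D, continuous y} -> {within D', continuous y}.
Proof. exact: continuous_subspaceW. Qed.

(** Only the right-hand side on the half-line matters, so it may be replaced by a
    function that is continuous on the whole line. *)
Lemma deriv_on_integral (t0 t : R) (g : R -> R) (y : R -> R) (c : R) :
  {within `[t0, +oo[, continuous g} -> t0 <= t ->
  (forall s, t0 <= s -> y s = c + \int[@lebesgue_measure R]_(e in `[t0, s]) g e) ->
  deriv_on `[t0, +oo[ (y : R -> R^o) t (g t).
Proof.
move=> cg t0t yE; pose G s := g (Num.max t0 s).
have GE s : t0 <= s -> G s = g s by move=> t0s; rewrite /G max_r.
have [Y [dY intY]] := primitive_exists (halfline_extension cg).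
apply: (@eq_deriv_on _ _ _ (fun s => (c - Y t0) + Y s)).
- by rewrite /= in_itv /= t0t.
- move=> s; rewrite /= in_itv /= andbT => t0s; rewrite yE //.
  have -> : \int[@lebesgue_measure R]_(e in `[t0, s]) g e =
      \int[@lebesgue_measure R]_(e in `[t0, s]) G e.
    by apply: eq_Rintegral => e; rewrite inE /= in_itv /= => /andP[/GE].
  by rewrite intY //; ring.
rewrite -(GE t t0t) -[G t]add0r.
apply: deriv_onD; first exact: deriv_on_cst.
by apply: is_derive_deriv_on.
Qed.

End HalflineContinuity.

Section Solutions.
Context (R : realType) (d n q : nat) (r t0 : R) (f : R -> 'cV[R]_d) (M : 'M[R]_d).
Hypothesis r_gt0 : 0 < r.
Hypothesis f_ode : forall tau, tau \in `[- r, 0] ->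
  deriv_on `[- r, 0] f tau (M *m f tau).
Variables (Omega : 'M[R]_(n, chidim d n q)) (x : R -> 'cV[R]_n).
Hypothesis cx : {within `[t0 - r, +oo[, continuous x}.

Let Z (t : R) : 'cV[R]_(chidim d n q) := chi r f x (fun=> 0) t.

Lemma sub_halfline : `[t0, +oo[%classic `<=` `[t0 - r, +oo[%classic.
Proof. by move=> s /=; rewrite !in_itv /= !andbT; have := r_gt0; lra. Qed.

Lemma chi_continuous i : {within `[t0, +oo[, continuous (fun t => Z t i 0)}.
Proof.
have cxi k : {within `[t0 - r, +oo[, continuous (fun s => x s k 0)}.
  exact: within_continuous_coord.
rewrite /Z /chi -[i]splitK; case: (fintype.split i) => {}i /=; last first.
  apply: eq_within_continuous (fun t => col_mxEd _ _ _ _) _.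
  exact: within_continuous_cst.
apply: eq_within_continuous (fun t => col_mxEu _ _ _ _) _.
rewrite -[i]splitK; case: (fintype.split i) => {}i /=.
  apply: eq_within_continuous (fun t => col_mxEu _ _ _ _) _.
  exact: within_continuous_subset sub_halfline _.
apply: eq_within_continuous (fun t => col_mxEd _ _ _ _) _.
rewrite -[i]splitK; case: (fintype.split i) => {}i /=.
  apply: eq_within_continuous (fun t => col_mxEu _ _ _ _) _.
  exact: (within_continuous_shift (y := fun s => x s i 0) (cxi i)).
apply: eq_within_continuous (fun t => col_mxEd _ _ _ _) _.
apply/subspace_continuousP => t /=; rewrite in_itv /= andbT => t0t.
exact: (deriv_on_within (@deriv_on_coord R _ _ _ _ _ _ i 0
  (deriv_on_window_int r_gt0 f_ode cx t0t))).
Qed.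

Lemma rhs_continuous i : {within `[t0, +oo[, continuous (fun t => (Omega *m Z t) i 0)}.
Proof.
apply: eq_within_continuous (fun t => mxE _ _ _ _) _.
apply: within_continuous_sum => k; apply: within_continuousM; last exact: chi_continuous.
exact: within_continuous_cst.
Qed.

(** Without input the right-hand side is continuous, hence a solution of the
    integrated equation is differentiable at every time. *)
Lemma solution_deriv phi t : is_solution r t0 f Omega phi (fun=> 0) x -> t0 <= t ->
  deriv_on `[t0, +oo[ x t (Omega *m Z t).
Proof.
move=> [_ _ xE] t0t; apply: deriv_on_mx => i j; rewrite ord1.
apply: (@deriv_on_integral R t0 t (fun s => (Omega *m Z s) i 0) (fun s => x s i 0)
  (phi 0 i 0)) => //; first exact: rhs_continuous.
by move=> s /xE ->; rewrite !mxE.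
Qed.

(** Every entry of the extended state is a bounded linear functional of the current
    segment. *)
Lemma chi_bounded : exists2 C, 0 <= C &
  forall t i, t0 <= t -> `|Z t i 0| <= C * sup_norm r (segment x t).
Proof.
have cf := ode_continuous r_gt0 f_ode.
have cs t : t0 <= t -> hist_cont r (segment x t) by exact: segment_hist_cont.
have r0 : - r <= 0 by rewrite oppr_le0 ltW.
have bd i : exists2 C, 0 <= C &
    forall t, t0 <= t -> `|Z t i 0| <= C * sup_norm r (segment x t).
  rewrite /Z /chi -[i]splitK; case: (fintype.split i) => {}i /=; last first.
    by exists 0 => // t _; rewrite col_mxEd mxE normr0 mul0r.
  rewrite -[i]splitK; case: (fintype.split i) => {}i /=.
    exists 1 => // t t0t; rewrite col_mxEu col_mxEu mul1r -[t in x t]addr0.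
    by apply: (coord_le_sup_norm r_gt0 i (cs t t0t)); rewrite lexx r0.
  rewrite -[i]splitK; case: (fintype.split i) => {}i /=.
    exists 1 => // t t0t; rewrite col_mxEu col_mxEd col_mxEu mul1r.
    by apply: (coord_le_sup_norm r_gt0 i (cs t t0t)); rewrite lexx r0.
  have [C C0 CP] := hist_int_bounded r_gt0 (cf (mxtens_unindex i).1 0) (mxtens_unindex i).2.
  exists C => // t t0t; rewrite col_mxEu !col_mxEd.
  by rewrite -[mxint _ _ _]/(window_int r f (segment x t)) window_intE; exact/CP/cs.
have [C CP] := choice (fun i => let: ex_intro2 c c0 cP := bd i in
  ex_intro (fun c => 0 <= c /\ forall t, t0 <= t -> `|Z t i 0| <= c * sup_norm r (segment x t))
    c (conj c0 cP)).
exists (\sum_i C i); first by apply: sumr_ge0 => i _; case: (CP i).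
move=> t i t0t; have [_ /(_ t t0t) h] := CP i; apply: le_trans h _.
apply: ler_wpM2r; first exact: sup_norm_ge0 (cs t t0t).
by rewrite (bigD1 i) //= lerDl sumr_ge0 // => j _; case: (CP j).
Qed.

End Solutions.

(** * Dissipativity and global asymptotic stability of one closed loop *)

Section ClosedLoopAnalysis.
Context (R : realType) (d n m q : nat) (r t0 : R) (f : R -> 'cV[R]_d) (M : 'M[R]_d).
Hypothesis r_gt0 : 0 < r.
Hypothesis f_ode : forall tau, tau \in `[- r, 0] ->
  deriv_on `[- r, 0] f tau (M *m f tau).
Hypothesis f_gram : posdef (gram r f).
Variables (Jt J1 : 'M[R]_m) (J2 : 'M[R]_(m, q)) (J3 : 'M[R]_q).
Hypothesis J1_neg : negdef (invmx J1).
Variables (P : 'M[R]_n) (Q : 'M[R]_(n, d * n)) (R0 : 'M[R]_(d * n)) (S U : 'M[R]_n).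
Hypotheses (P_sym : P^T = P) (R0_sym : R0^T = R0).
Hypotheses (S_pos : posdef S) (U_pos : posdef U).
Hypothesis lmi : posdef (lyap_lmi r f P Q R0 S).
Variables (Omega : 'M[R]_(n, chidim d n q)) (Psi : 'M[R]_(m, chidim d n q)) (eps : R).
Hypothesis eps_gt0 : 0 < eps.
Hypothesis dissip : forall (x0 x1 : 'cV[R]_n) (eta : 'cV[R]_(d * n)) (w : 'cV[R]_q) c,
  c = col_mx (col_mx x0 (col_mx x1 eta)) w ->
  2 * dot (P *m x0 + Q *m eta) (Omega *m c)
  + 2 * dot (Q^T *m x0 + R0 *m eta) (bfF n q r f M *m c)
  + qform (S + r *: U) x0 - qform S x1 - qform (Fgram r f *t U) eta
  - supply Jt J1 J2 J3 (Psi *m c) w <= - (eps * dot c c).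

Local Notation v := (lyapunov r f P Q R0 S U).

(** The derivative of the functional contains the integral of [qform U], which is not a
    function of the extended state; Bessel's inequality replaces it by the term
    [qform (Fgram r f *t U)] of the matrix inequality. *)
Lemma lyapunov_dissipation (x : R -> 'cV[R]_n) (w : R -> 'cV[R]_q) t :
  {within `[t0 - r, +oo[, continuous x} -> t0 <= t ->
  deriv_on `[t0, +oo[ x t (Omega *m chi r f x w t) ->
  exists2 dv : R, deriv_on `[t0, +oo[ (fun s => v (segment x s) : R^o) t dv &
    dv - supply Jt J1 J2 J3 (Psi *m chi r f x w t) (w t)
      <= - (eps * dot (chi r f x w t) (chi r f x w t)).
Proof.
move=> cx t0t dx.
have dv := deriv_on_lyapunov (S := S) (U := U) r_gt0 f_ode P_sym R0_sym cx t0t dx.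
eexists; first exact: dv.
have := dissip (erefl (chi r f x w t)).
have cphi := hist_cont_coord (segment_hist_cont cx t0t).
have := window_int_bessel (ode_continuous r_gt0 f_ode) f_gram U_pos cphi.
rewrite bfF_col /window_int /segment; lra.
Qed.

Lemma lyapunov_dissipative :
  dissipative r t0 f Omega Psi (supply Jt J1 J2 J3).
Proof.
exists v; split.
- split; first by move=> phi psi _ _; exact: eq_lyapunov.
  by move=> phi; exact: (lyapunov_ge0 r_gt0 f_ode).
- exact/hist_quadratic_differentiable/(lyapunov_quadratic r_gt0 f_ode).
move=> phi w x _ _ [cx _ _] t t0t dx.
have [dv dvP dvle] := lyapunov_dissipation cx t0t dx; exists dv => //.
by apply: le_trans dvle _; rewrite oppr_le0 mulr_ge0 ?dot_ge0 ?ltW.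
Qed.

Section Unforced.
Variables (phi : R -> 'cV[R]_n) (x : R -> 'cV[R]_n).
Hypothesis phi_cont : hist_cont r phi.
Hypothesis sol : is_solution r t0 f Omega phi (fun=> 0) x.

Let cx : {within `[t0 - r, +oo[, continuous x}. Proof. by case: sol. Qed.

Local Notation W t := (v (segment x t)).

(** For zero input the supply rate is the form of [J1^-1] at [Jt *m z], which is nonpositive:
    dissipativity becomes strict decay. *)
Lemma lyapunov_rate : exists dW : R -> R, forall t, t0 <= t ->
  deriv_on `[t0, +oo[ (fun s => W s : R^o) t (dW t) /\
  dW t <= - (eps * dot (x t) (x t)).
Proof.
have : forall t, exists l, t0 <= t ->
    deriv_on `[t0, +oo[ (fun s => W s : R^o) t l /\ l <= - (eps * dot (x t) (x t)).
  move=> t; have [t0t|] := leP t0 t; last by exists 0.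
  have [l lP lle] := lyapunov_dissipation cx t0t (solution_deriv r_gt0 f_ode cx sol t0t).
  exists l => _; split => //.
  have s0 : supply Jt J1 J2 J3 (Psi *m chi r f x (fun=> 0) t) 0 <= 0.
    rewrite /supply qform_block mulmx0 dot0r mulr0 qform0 !addr0.
    rewrite qformE -!mulmxA -{1}[Jt]trmxK -dot_mulmx trmxK -qformE -oppr_ge0 -qformN.
    exact: posdef_ge0.
  have : dot (x t) (x t) <=
      dot (chi r f x (fun=> 0 : 'cV[R]_q) t) (chi r f x (fun=> 0) t).
    rewrite /chi !dot_col -!addrA lerDl.
    by rewrite !addr_ge0 ?dot_ge0.
  move=> /(ler_wpM2l (ltW eps_gt0)); lra.
by move=> /choice[dW dWP]; exists dW.
Qed.

Lemma lyapunov_nonincreasing a b : t0 <= a -> a <= b -> W b <= W a.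
Proof.
move=> t0a ab; have [dW dWP] := lyapunov_rate.
have := @deriv_on_le_growth R t0 (fun s => W s) dW a b 0 t0a ab.
rewrite mul0r subr_le0; apply; first by move=> t /dWP[].
move=> t /andP[at_ _]; have [_ h] := dWP t (le_trans t0a at_).
by apply: le_trans h _; rewrite oppr_le0 mulr_ge0 ?dot_ge0 ?ltW.
Qed.

Lemma lyapunov_initial : W t0 = v phi.
Proof.
by have [_ ini _] := sol; apply: eq_lyapunov => // theta /ini.
Qed.

Lemma solution_energy : exists2 c, 0 < c &
  forall t, t0 <= t -> c * `|x t| ^+ 2 <= v phi.
Proof.
have [c c0 cP] := lyapunov_coercive r_gt0 f_ode f_gram S_pos U_pos lmi; exists c => // t t0t.
have := cP _ (segment_hist_cont cx t0t); rewrite /segment addr0 => h.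
apply: le_trans h _; rewrite -lyapunov_initial; exact: lyapunov_nonincreasing.
Qed.

Lemma solution_bounded : exists B, forall t, t0 <= t ->
  sup_norm r (segment x t) <= B.
Proof.
have [c c0 cP] := solution_energy.
(* [a <= 1 + a ^+ 2] turns the bound on the square into one on the norm. *)
pose E := 1 + v phi / c; exists (sup_norm r phi + E).
have vphi : 0 <= v phi by exact: (lyapunov_ge0 r_gt0 f_ode).
have E0 : 0 <= E by rewrite addr_ge0 // divr_ge0 // ltW.
have far s : t0 <= s -> `|x s| <= E.
  move=> /cP; rewrite mulrC -ler_pdivlMr // => h.
  have := sqr_ge0 (`|x s| - 1); rewrite /E; nra.
move=> t t0t; apply: ge_sup.
  by exists `|segment x t 0|, 0 => //=; rewrite in_itv /= lexx oppr_le0 ltW.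
move=> u [s /=]; rewrite in_itv /= => /andP[rs s0] <-{u}; rewrite /segment.
(* The part of the window before [t0] lies in the initial function. *)
have [ts|ts] := leP t0 (t + s).
  by apply: le_trans (far _ ts) _; rewrite lerDr sup_norm_ge0.
have [_ ini _] := sol.
have sin : - r <= t + s - t0 <= 0 by lra.
have := ini (t + s - t0); rewrite in_itv /= => /(_ sin); rewrite addrC subrK => ->.
by apply: le_trans (le_sup_norm _ phi_cont sin) _ => //; rewrite lerDl.
Qed.

Lemma solution_lipschitz : exists2 L, 0 < L & forall i a b, t0 <= a -> a <= b ->
  `|x b i 0 - x a i 0| <= L * (b - a).
Proof.
have [C C0 CP] := chi_bounded q r_gt0 f_ode cx.
have [B BP] := solution_bounded.
pose L i := \sum_j `|Omega i j| * (C * B).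
have rhs i t : t0 <= t -> `|(Omega *m chi r f x (fun=> 0) t) i 0| <= L i.
  move=> t0t; rewrite mxE; apply: le_trans (ler_norm_sum _ _ _) _.
  apply: ler_sum => j _; rewrite normrM ler_wpM2l //.
  by apply: le_trans (CP t j t0t) _; rewrite ler_wpM2l // BP.
have L0 i : 0 <= L i by apply: le_trans (rhs i t0 _).
exists (1 + \sum_i L i); first by rewrite ltr_pwDl // sumr_ge0.
move=> i a b t0a ab.
have Li : L i <= 1 + \sum_i L i.
  rewrite (bigD1 i) //= addrCA lerDl addr_ge0 // sumr_ge0 //.
have dxi t : t0 <= t -> deriv_on `[t0, +oo[ (fun s => x s i 0 : R^o) t
    ((Omega *m chi r f x (fun=> 0) t) i 0).
  by move=> t0t; apply: deriv_on_coord; exact: (solution_deriv r_gt0 f_ode cx sol).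
have up := @deriv_on_le_growth R t0 (fun s => x s i 0)
  (fun t => (Omega *m chi r f x (fun=> 0) t) i 0) a b (L i) t0a ab dxi.
have dn := @deriv_on_le_growth R t0 (fun s => -1 * x s i 0)
  (fun t => -1 * (Omega *m chi r f x (fun=> 0) t) i 0) a b (L i) t0a ab
  (fun t h => @deriv_onZ R _ _ _ _ (-1) (dxi t h)).
apply: (@le_trans _ _ (L i * (b - a))); last by rewrite ler_wpM2r // subr_ge0.
rewrite ler_norml; apply/andP; split.
  rewrite lerNl; have -> : - (x b i 0 - x a i 0) = -1 * x b i 0 - -1 * x a i 0 by ring.
  apply: dn => t /andP[at_ _]; have := rhs i t (le_trans t0a at_).
  by rewrite mulN1r ler_norml lerNl => /andP[].
apply: up => t /andP[at_ _]; have := rhs i t (le_trans t0a at_).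
by rewrite ler_norml => /andP[].
Qed.

(** While a coordinate stays above [e / 2] the functional decreases at a fixed rate, and
    by the Lipschitz bound it stays there for a fixed time once it has reached [e]; as the
    functional is nonnegative this cannot happen at arbitrarily late times. *)
Lemma solution_attracted : x t @[t --> +oo] --> (0 : 'cV[R]_n).
Proof.
apply: cvg_mx_coord => i j; rewrite mxE ord1; apply/cvgr0Pnorm_lt => e e0.
have [L L0 LP] := solution_lipschitz; have [dW dWP] := lyapunov_rate.
pose h := e / (2 * L); pose kappa := eps * (e / 2) ^+ 2 * h.
have h0 : 0 < h by rewrite divr_gt0 // mulr_gt0.
have kappa0 : 0 < kappa by do 2!apply: mulr_gt0 => //; apply: exprn_gt0; exact: divr_gt0.
have Wge0 t : t0 <= t -> 0 <= W t.
  by move=> t0t; apply: (lyapunov_ge0 r_gt0 f_ode) => //; exact: segment_hist_cont.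
have infW : has_inf [set W t | t in `[t0, +oo[].
  split; first by exists (W t0), t0 => //=; rewrite in_itv /= lexx.
  by exists 0 => u [t /=]; rewrite in_itv /= andbT => t0t <-; exact: Wge0.
have [u [T /=]] := inf_adherent kappa0 infW; rewrite in_itv /= andbT => t0T <-{u} WT.
exists T; split; first exact: num_real.
move=> t Tt; rewrite ltNge; apply/negP => ext.
have t0t := le_trans t0T (ltW Tt).
have tth : t <= t + h by rewrite lerDl ltW.
have dec : W (t + h) - W t <= - (eps * (e / 2) ^+ 2) * (t + h - t).
  apply: (@deriv_on_le_growth R t0 (fun s => W s) dW t (t + h)) => //.
    by move=> s /dWP[].
  move=> s /andP[ts sth]; have [_ le1] := dWP s (le_trans t0t ts).
  apply: le_trans le1 _; rewrite lerN2 (ler_wpM2l (ltW eps_gt0)) //.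
  apply: le_trans (sqr_coord_le_dot _ i).
  rewrite -[x s i 0 ^+ 2]real_normK ?num_real // ler_pXn2r ?nnegrE //; last first.
    by rewrite divr_ge0 // ltW.
  have := LP i t s t0t ts.
  have : L * (s - t) <= e / 2.
    apply: (@le_trans _ _ (L * h)); first by apply: (ler_wpM2l (ltW L0)); lra.
    by rewrite /h le_eqVlt; apply/orP; left; apply/eqP; field; rewrite gt_eqF.
  have := ler_normB (x s i 0) (x s i 0 - x t i 0); rewrite opprB addrCA subrr addr0.
  lra.
have low : inf [set W t | t in `[t0, +oo[] <= W (t + h).
  apply: ge_inf; first by case: infW.
  by exists (t + h) => //=; rewrite in_itv /= andbT; lra.
have := lyapunov_nonincreasing t0T (ltW Tt).
move: dec WT low; have -> : t + h - t = h by ring.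
rewrite /kappa; lra.
Qed.

End Unforced.

Lemma lyapunov_stable : globally_asymptotically_stable r t0 f Omega.
Proof.
split; last by move=> phi x cphi sol; exact: solution_attracted sol.
move=> e e0.
have [c c0 cP] := lyapunov_coercive r_gt0 f_ode f_gram S_pos U_pos lmi.
have [C C0 CP] := hist_quadratic_bounded (lyapunov_quadratic r_gt0 f_ode P Q R0 S U).
(* This [k] satisfies [k <= 1] and [C * k < c], hence [C * (e * k) ^+ 2 < c * e ^+ 2]. *)
pose k := c / (C + c).
have Cc : 0 < C + c by rewrite ltr_wpDl.
have k0 : 0 < k by rewrite divr_gt0.
have k1 : k <= 1 by rewrite ler_pdivrMr // mul1r lerDr.
have kE : k * (C + c) = c by rewrite /k divfK // gt_eqF.
exists (e * k); first exact: mulr_gt0.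
move=> phi x cphi small sol t t0t; have [cx _ _] := sol.
have := cP _ (segment_hist_cont cx t0t); rewrite /segment addr0 => lo.
have mid := lyapunov_nonincreasing sol (lexx t0) t0t.
have := CP _ cphi; rewrite -(lyapunov_initial sol) => hi.
have sq : sup_norm r phi ^+ 2 <= (e * k) ^+ 2.
  rewrite ler_pXn2r ?nnegrE ?(ltW small) //; first exact: sup_norm_ge0.
  by rewrite mulr_ge0 // ltW.
rewrite -(ltr_pXn2r (n := 2)) ?nnegrE ?(ltW e0) // -(ltr_pM2l c0).
apply: (le_lt_trans lo); apply: (le_lt_trans mid); apply: (le_lt_trans hi).
apply: (@le_lt_trans _ _ (C * (e * k) ^+ 2)); first by rewrite ler_wpM2l.
have -> : C * (e * k) ^+ 2 = (C * k * k) * e ^+ 2 by ring.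
rewrite ltr_pM2r ?exprn_gt0 //; nra.
Qed.

End ClosedLoopAnalysis.

(** * Robustness *)

Theorem theorem3p1 (R : realType) (d n p m q : nat) (r t0 : R)
    (f : R -> 'cV[R]_d) (M : 'M[R]_d)
    (pl : plant R d n p m q)
    (cx : channels R d n p q n) (cz : channels R d n p q m)
    (K : 'M[R]_(p, n))
    (Jt J1 : 'M[R]_m) (J2 : 'M[R]_(m, q)) (J3 : 'M[R]_q)
    (r_gt0 : 0 < r)
    (f_C1 : C1_on `[- r, 0] f)
    (f_ode : forall tau, tau \in `[- r, 0] ->
       deriv_on `[- r, 0] f tau (M *m f tau))
    (f_gram : posdef (gram r f))
    (cx_ok : multipliers_ok cx) (cz_ok : multipliers_ok cz)
    (J1_sym : J1^T = J1) (J1_unit : J1 \in unitmx) (J1_neg : negdef (invmx J1))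
    (J3_sym : J3^T = J3)
    (lmis : exists (P : 'M[R]_n) (Q : 'M[R]_(n, d * n)) (R0 : 'M[R]_(d * n))
       (S U : 'M[R]_n) (k1 k2 : R),
       [/\ P^T = P, R0^T = R0, S^T = S & U^T = U] /\
       [/\ 0 < k1, 0 < k2, posdef (lyap_lmi r f P Q R0 S), posdef S & posdef U] /\
       posdef (well_posed_lmi cx cz k1) /\
       negdef (main_lmi cx cz r f M pl K Jt J1 J2 J3 P Q R0 S U k2)) :
  robustly (fun (Dx : deltas cx) (Dz : deltas cz) =>
    dissipative r t0 f (state_mx pl Dx K) (output_mx pl Dz K)
      (supply Jt J1 J2 J3)) /\
  robustly (fun (Dx : deltas cx) (Dz : deltas cz) =>
    globally_asymptotically_stable r t0 f (state_mx pl Dx K)).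
Proof.
case: lmis => P [Q [R0 [S [U [k1 [k2]]]]]].
move=> [[sP sR _ _] [[k10 k20 lmi0 pS pU] [lmi1 lmi2]]].
have robust (Dx : deltas cx) (Dz : deltas cz) : admissible Dx -> admissible Dz ->
    [/\ well_posed Dx, well_posed Dz,
      dissipative r t0 f (state_mx pl Dx K) (output_mx pl Dz K) (supply Jt J1 J2 J3) &
      globally_asymptotically_stable r t0 f (state_mx pl Dx K)].
  move=> aDx aDz.
  have [uDx uDz] := loops_unit cx_ok cz_ok aDx aDz k10 lmi1.
  have [eps eps0 dissip] := closed_loop_dissipation cx_ok cz_ok aDx aDz k10 lmi1
    J1_unit sP sR k20 lmi2.
  split; [exact: well_posed_sum | exact: well_posed_sum | |].
  - exact: (lyapunov_dissipative _ r_gt0 f_ode f_gram sP sR pS pU lmi0 eps0 dissip).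
  - exact: (lyapunov_stable _ r_gt0 f_ode f_gram J1_neg sP sR pS pU lmi0 eps0 dissip).
by split=> Dx Dz aDx aDz; have [] := robust Dx Dz aDx aDz.
Qed.
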